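(* Let $G$ be a finite group, $k$ a field of characteristic $2$, and let $\zeta\in H^n(G,k)$ be a nonzero cohomology class of degree $n\ge1$. Then the following are equivalent: (i) $\zeta$ is semi-productive. (ii) For every $v\in H^*(G,k)$ satisfying $v\zeta=0$, the Massey product $\langle\zeta,v,\zeta\rangle\equiv0$ mod $(\zeta)$. (iii) For every $v\in H^*(G,k)$ satisfying $v\zeta=0$, the product $v\,\widetilde{Sq}^{n-1}\zeta\equiv0$ mod $(\zeta)$.
   Context: All modules are finitely generated. $(\zeta)$ is the ideal of $H^*(G,k)$ generated by $\zeta$. Semi-productive: let $P_*$ be a minimal projective resolution of the trivial module $k$ and $\Omega^nk=\ker(P_{n-1}\to P_{n-2})$ (with $P_{-1}=k$). The class $\zeta$ is represented by a $kG$-homomorphism $\hat\zeta:\Omega^nk\to k$, and $L_\zeta=\ker\hat\zeta$. The class $\zeta$ is semi-productive if it annihilates $\mathrm{Ext}^*_{kG}(L_\zeta,k)$, where $H^*(G,k)=\mathrm{Ext}^*_{kG}(k,k)$ acts by Yoneda splice over $k$. Massey product: let $\mathbf{P}$ be a projective resolution of $k$, $(\Sigma^m\mathbf{P})_i=\mathbf{P}_{i-m}$ with differential $(-1)^m\partial$, and identify $H^m(G,k)$ with the group $[\mathbf{P},\Sigma^m\mathbf{P}]$ of homotopy classes of chain maps; the product is composition (after suspending). For homogeneous $u,v,w$ of degrees $r,s,t$, represented by chain maps $\hat u:\mathbf{P}\to\Sigma^r\mathbf{P}$, $\hat v:\mathbf{P}\to\Sigma^s\mathbf{P}$, $\hat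 w:\mathbf{P}\to\Sigma^t\mathbf{P}$, with $uv=0=vw$, choose $H:\mathbf{P}\to\Sigma^{r+s-1}\mathbf{P}$ and $K:\mathbf{P}\to\Sigma^{s+t-1}\mathbf{P}$ with $\partial H+H\partial=\hat u\hat v$ and $\partial K+K\partial=\hat v\hat w$. Then $H\hat w+\hat uK$ is a chain map $\mathbf{P}\to\Sigma^{r+s+t-1}\mathbf{P}$, and $\langle u,v,w\rangle$ denotes its class in $H^{r+s+t-1}(G,k)$, well defined modulo $uH^{s+t-1}(G,k)+wH^{r+s-1}(G,k)$. In statement (ii), $v$ is homogeneous, as Massey products are defined for homogeneous classes. Semilinear Steenrod square: $H^*(G,k)\cong k\otimes_{\mathbb{F}_2}H^*(G,\mathbb{F}_2)$ has a $k$-basis $\{u_i\}$ lying in $H^*(G,\mathbb{F}_2)$, and $\widetilde{Sq}^{n-1}(\sum_i\lambda_iu_i)=\sum_i\lambda_i^2Sq^{n-1}u_i$. *)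

(* Defs.v *)
From HB Require Import structures.
From mathcomp Require Import all_boot all_order all_algebra all_fingroup.

Set Implicit Arguments.
Unset Strict Implicit.
Unset Printing Implicit Defensive.

Import GRing.Theory.
Local Open Scope ring_scope.

(** * Homological algebra over a ring *)

Section Kernel.
Variables (A : pzRingType) (V W : lmodType A) (f : {linear V -> W}).

Definition ker_pred : {pred V} := fun x => f x == 0.

Fact ker_pred_submod : submod_closed ker_pred.
Proof.
split=> [|a x y]; rewrite !unfold_in ?linear0 // => /eqP fx /eqP fy.
by rewrite linearP fx fy scaler0 addr0.
Qed.
HB.instance Definition _ := GRing.isSubmodClosed.Build A V ker_pred ker_pred_submod.

Record kernel := Kernel { ker_val :> V; ker_valP : ker_val \in ker_pred }.
HB.instance Definition _ := [isSub for ker_val].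
HB.instance Definition _ := [Choice of kernel by <:].
HB.instance Definition _ := [SubChoice_isSubLmodule of kernel by <:].

End Kernel.

Section Corestriction.
Variables (A : pzRingType) (U V W : lmodType A).
Variables (f : {linear V -> W}) (g : {linear U -> V}).
Hypothesis fg0 : forall x, f (g x) = 0.

Fact corestr_subproof x : g x \in ker_pred f.
Proof. by rewrite unfold_in fg0. Qed.

Definition corestr x : kernel f := Kernel (corestr_subproof x).

Fact corestr_is_linear : linear corestr.
Proof. by move=> a x y; apply: val_inj; rewrite /= !linearP. Qed.
HB.instance Definition _ := GRing.isLinear.Build A U (kernel f) *:%R corestr corestr_is_linear.

End Corestriction.

Definition projective (A : pzRingType) (P : lmodType A) : Prop :=
  forall (M N : lmodType A) (p : {linear M -> N}) (f : {linear P -> N}),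
    (forall y, exists x, p x = y) ->
    exists g : {linear P -> M}, forall x, p (g x) = f x.

Definition fin_gen (A : pzRingType) (M : lmodType A) : Prop :=
  exists (m : nat) (e : 'I_m -> M),
    forall x, exists a : 'I_m -> A, x = \sum_(i < m) a i *: e i.

Record resolution (A : pzRingType) (M : lmodType A) := Resolution {
  term :> nat -> lmodType A;
  diff : forall i, {linear term i.+1 -> term i};
  aug : {linear term 0 -> M};
  term_projective : forall i, projective (term i);
  term_fin_gen : forall i, fin_gen (term i);
  aug_surj : forall y, exists x, aug x = y;
  aug_exact : forall x, aug x = 0 <-> exists y, diff 0 y = x;
  diff_exact : forall i x, diff i x = 0 <-> exists y, diff i.+1 y = x }.

(* [P i] is a projective cover of the cokernel of [diff P i]. *)
Definition minimal (A : pzRingType) (M : lmodType A) (P : resolution M) : Prop :=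
  forall i (N : {pred P i}), submod_closed N ->
    (forall x, exists2 y, y \in N & exists w, x = y + diff P i w) ->
    forall x, x \in N.

Section Syzygy.
Variables (A : pzRingType) (M : lmodType A) (P : resolution M).

(* The augmented complex, with [M] in degree -1: [P i -> P (i - 1)]. *)
Definition prev_term i : lmodType A := if i is j.+1 then P j else M.

Definition aug_diff i : {linear P i -> prev_term i} :=
  match i return {linear P i -> prev_term i} with
  | 0 => aug P
  | j.+1 => diff P j
  end.

Fact aug_diffK i x : aug_diff i (diff P i x) = 0.
Proof.
by case: i x => [|i] x /=; [apply/aug_exact | apply/diff_exact]; exists x.
Qed.

(* Omega^n M, with Omega^0 M = M, and the canonical surjection onto it. *)
Definition syzygy n : lmodType A := if n is m.+1 then kernel (aug_diff m) else M.

Definition syzygy_map n : {linear P n -> syzygy n} :=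
  match n return {linear P n -> syzygy n} with
  | 0 => aug P
  | m.+1 => corestr (@aug_diffK m)
  end.

Variable N : lmodType A.

Definition hom_cocycle n (f : P n -> N) : Prop := forall x, f (diff P n x) = 0.

Definition hom_coboundary n : (P n -> N) -> Prop :=
  match n return (P n -> N) -> Prop with
  | 0 => fun f => forall x, f x = 0
  | m.+1 => fun f => exists h : {linear P m -> N}, forall x, f x = h (diff P m x)
  end.

End Syzygy.

(** * Group algebra and trivial module *)

(* The first argument only serves to infer the kG-module structure. *)
Definition trivmod (gT : finGroupType) (k : fieldType) : Type := k.

Section GroupAlgebra.
Variables (gT : finGroupType) (k : fieldType).

Definition grpalg := {ffun gT -> k}.
HB.instance Definition _ := GRing.Zmodule.on grpalg.
Implicit Types a b c : grpalg.

Definition grp_elt (g : gT) : grpalg := [ffun x => (x == g)%:R].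

Definition grpalg_mul a b : grpalg :=
  [ffun x => \sum_(y : gT) a y * b (y^-1 * x)%g].

Fact grpalg_mulA : associative grpalg_mul.
Proof.
move=> a b c; apply/ffunP=> x; rewrite !ffunE.
under eq_bigr => y _ do rewrite ffunE mulr_sumr.
under [RHS]eq_bigr => z _ do rewrite ffunE mulr_suml.
rewrite [RHS]exchange_big /=; apply: eq_bigr => y _.
rewrite (reindex_inj (mulgI y^-1%g)) /=; apply: eq_bigr => z _.
by rewrite mulrA invMg invgK -mulgA mulKVg.
Qed.

Fact grpalg_mul1l : left_id (grp_elt 1%g) grpalg_mul.
Proof.
move=> a; apply/ffunP=> x; rewrite ffunE (bigD1 1%g) //= ffunE eqxx mul1r.
rewrite invg1 mul1g big1 ?addr0 // => y /negPf ny.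
by rewrite ffunE ny mul0r.
Qed.

Fact grpalg_mul1r : right_id (grp_elt 1%g) grpalg_mul.
Proof.
move=> a; apply/ffunP=> x; rewrite ffunE (bigD1 x) //= ffunE mulVg eqxx mulr1.
rewrite big1 ?addr0 // => y /negPf ny.
by rewrite ffunE -eq_mulVg1 ny mulr0.
Qed.

Fact grpalg_mulDl : left_distributive grpalg_mul +%R.
Proof.
move=> a b c; apply/ffunP=> x; rewrite !ffunE -big_split /=.
by apply: eq_bigr => y _; rewrite ffunE mulrDl.
Qed.

Fact grpalg_mulDr : right_distributive grpalg_mul +%R.
Proof.
move=> a b c; apply/ffunP=> x; rewrite !ffunE -big_split /=.
by apply: eq_bigr => y _; rewrite ffunE mulrDr.
Qed.

HB.instance Definition _ := GRing.Zmodule_isPzRing.Build grpalg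
  grpalg_mulA grpalg_mul1l grpalg_mul1r grpalg_mulDl grpalg_mulDr.

Local Notation triv := (trivmod gT k).
HB.instance Definition _ := GRing.Zmodule.copy triv k.

Definition triv_scale (a : grpalg) (x : triv) : triv :=
  (\sum_(g : gT) a g) * (x : k).

Fact triv_scaleA a b x : triv_scale a (triv_scale b x) = triv_scale (a * b) x.
Proof.
rewrite /triv_scale mulrA; congr (_ * _); rewrite mulr_suml.
under [RHS]eq_bigr => g _ do rewrite ffunE.
rewrite exchange_big /=; apply: eq_bigr => y _.
by rewrite -mulr_sumr [in LHS](reindex_inj (mulgI y^-1%g)).
Qed.

Fact triv_scale1 : left_id 1 triv_scale.
Proof.
move=> x; rewrite /triv_scale (bigD1 1%g) //= ffunE eqxx big1 ?addr0 ?mul1r //.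
by move=> g /negPf ng; rewrite ffunE ng.
Qed.

Fact triv_scaleDr : right_distributive triv_scale +%R.
Proof. by move=> a x y; rewrite /triv_scale mulrDr. Qed.

Fact triv_scaleDl x : {morph triv_scale^~ x : a b / a + b}.
Proof.
move=> a b; rewrite /triv_scale -mulrDl -big_split /=; congr (_ * _).
by apply: eq_bigr => g _; rewrite ffunE.
Qed.

HB.instance Definition _ := GRing.Zmodule_isLmodule.Build grpalg triv
  triv_scaleA triv_scale1 triv_scaleDr triv_scaleDl.

End GroupAlgebra.

(** * Group cohomology *)

(* H^*(G,R) is computed by the homogeneous standard resolution, whose degree n
   term is free on G^(n+1) with diagonal action.  A (possibly inhomogeneous)
   cochain is a function on lists of elements of G; its degree n component is
   its restriction to the lists [g_0; ...; g_n] of size n+1.  A class is given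
   by a cocycle, and equality of classes is [cohomologous]. *)
Section Cochains.
Variables (gT : finGroupType) (R : comNzRingType).
Implicit Types (f h c : seq gT -> R) (s : seq gT).

Definition cochain f : Prop :=
  [/\ f [::] = 0,
      forall g s, f [seq (g * x)%g | x <- s] = f s
    & exists N, forall s, (N < size s)%N -> f s = 0].

Definition face i s : seq gT := take i s ++ drop i.+1 s.

Definition codiff f s : R := \sum_(i < size s) (-1) ^+ i * f (face i s).

Definition cocycle f : Prop := cochain f /\ forall s, codiff f s = 0.

Definition cohomologous f h : Prop :=
  exists2 c, cochain c & forall s, f s - h s = codiff c s.

Definition homog n f : Prop := forall s, size s != n.+1 -> f s = 0.

(* f(g_0,...,g_p) h(g_p,...,g_m) *)
Definition cup f h s : R :=
  \sum_(p < size s) f (take p.+1 s) * h (drop p s).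

(* Steenrod's cup-1 product without signs (characteristic 2): the sum over
   i < j of f(g_0,...,g_i,g_j,...,g_m) h(g_i,...,g_j). *)
Definition cup1 f h s : R :=
  \sum_(i < size s) \sum_(j < size s | (i < j)%N)
    f (take i.+1 s ++ drop j s) * h (take (j - i).+1 (drop i s)).

(* Membership of the class of [f] in the ideal generated by that of [z]. *)
Definition in_ideal z f : Prop :=
  exists2 x, cocycle x & cohomologous f (cup x z).

End Cochains.

(* Sq^(n-1) on H^n(G,F_2): Steenrod's definition of Sq^(n-i) u is the class of
   the cup-i square of a cocycle representing u. *)
Definition Sq_pred (gT : finGroupType) (u : seq gT -> 'F_2) : seq gT -> 'F_2 :=
  cup1 u u.

Section SemilinearSquare.
Variables (gT : finGroupType) (k : fieldType).

(* The natural number representing a class mod 2 is read in k; this is the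
   inclusion of the prime field when k has characteristic 2. *)
Definition F2_incl (a : 'F_2) : k := (a : nat)%:R.

Definition lin_comb m (l : 'I_m -> k) (u : 'I_m -> seq gT -> 'F_2) : seq gT -> k :=
  fun s => \sum_(i < m) l i * F2_incl (u i s).

Definition F2_basis n m (u : 'I_m -> seq gT -> 'F_2) : Prop :=
  (forall i, cocycle (u i) /\ homog n (u i)) /\
  (forall z : seq gT -> k, cocycle z -> homog n z ->
     exists! l : {ffun 'I_m -> k}, cohomologous z (lin_comb l u)).

(* [w] represents the semilinear square of degree n-1 of the class of [z],
   which is of degree n. *)
Definition semilin_Sq n (z w : seq gT -> k) : Prop :=
  exists (m : nat) (u : 'I_m -> seq gT -> 'F_2) (l : 'I_m -> k),
    [/\ F2_basis n u,
        cohomologous z (lin_comb l u)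
      & cohomologous w (lin_comb (fun i => l i ^+ 2) (fun i => Sq_pred (u i)))].

End SemilinearSquare.

Section Comparison.
Variables (gT : finGroupType) (k : fieldType).
Local Notation kG := (grpalg gT k).
Local Notation kk := (trivmod gT k : lmodType kG).
Variable P : resolution kk.

(* An augmentation-preserving chain map from the standard resolution to [P],
   given by its values on the k-bases G^(n+1). *)
Definition comparison (psi : forall n, seq gT -> P n) : Prop :=
  [/\ forall n g s, size s = n.+1 ->
        psi n [seq (g * x)%g | x <- s] = grp_elt k g *: psi n s,
      forall g, aug P (psi 0 [:: g]) = (1 : k)
    & forall n s, size s = n.+2 ->
        diff P n (psi n.+1 s) = \sum_(i < n.+2) (-1) ^+ i *: psi n (face i s)].

(* The cocycle [f] on [P n] and the cochain [z] define the same class in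
   H^n(G,k). *)
Definition represents n (f : P n -> kk) (z : seq gT -> k) : Prop :=
  exists2 psi, comparison psi &
    cohomologous z (fun s => if size s == n.+1 then f (psi n s) else 0).

End Comparison.

(** * Semi-productive classes *)

Section SemiProductive.
Variables (gT : finGroupType) (k : fieldType).
Local Notation kG := (grpalg gT k).
Local Notation kk := (trivmod gT k : lmodType kG).
Variable P : resolution kk.

(* [P] is meant to be minimal and [z] of degree n.  Here [kernel zh] is L_zeta.
   The Yoneda splice of the class of [x] in Ext^i(L_zeta,k) with zeta is
   obtained by lifting [x] to a chain map [xh] from the resolution [Q],
   truncated at degree i, to [P], and composing with the cocycle
   P_n -> Omega^n k -> k. *)
Definition semi_productive n (z : seq gT -> k) : Prop :=
  forall zh : {linear syzygy P n -> kk},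
    represents (fun y : P n => zh (syzygy_map P n y)) z ->
  forall (Q : resolution (kernel zh)) (i : nat) (x : {linear Q i -> kk}),
    hom_cocycle x ->
  forall xh : (forall j, {linear Q (j + i)%N -> P j}),
    (forall y, aug P (xh 0 y) = x y) ->
    (forall j y, diff P j (xh j.+1 y) = xh j (diff Q (j + i)%N y)) ->
  hom_coboundary (fun y : Q (n + i)%N => zh (syzygy_map P n (xh n y))).

End SemiProductive.

(** * Massey products *)

Section Massey.
Variables (gT : finGroupType) (k : fieldType).
Local Notation kG := (grpalg gT k).
Local Notation kk := (trivmod gT k : lmodType kG).
Variable P : resolution kk.

(* A graded map P -> Sigma^r P has components P_(j+r) -> P_j.  To avoid casts
   it is given by a doubly indexed family, of which only the components [u i j]
   with i = j + r matter. *)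
Definition graded_map := forall i j : nat, {linear P i -> P j}.

Definition chain_map r (u : graded_map) : Prop :=
  forall i j, i = (j + r)%N ->
    forall x, (-1) ^+ r *: diff P j (u i.+1 j.+1 x) = u i j (diff P i x).

Definition chain_represents r (u : graded_map) (z : seq gT -> k) : Prop :=
  chain_map r u /\ represents (fun x : P r => aug P (u r 0 x)) z.

(* dH + Hd = uv, for u of degree r, v of degree s and H of degree r + s - 1,
   where r + s > 0. *)
Definition homotopy r s (u v H : graded_map) : Prop :=
  forall i j, i.+1 = (j + (r + s))%N ->
    forall x, diff P j (H i.+1 j.+1 x) + H i j (diff P i x)
              = u (j + r)%N j (v i.+1 (j + r)%N x).

(* [m] represents a value of <u,v,w>, for classes of degrees r, s, t such that
   r + s > 0 and s + t > 0. *)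
Definition massey r s t (u v w m : seq gT -> k) : Prop :=
  exists uh vh wh H K : graded_map,
    [/\ chain_represents r uh u, chain_represents s vh v
      & chain_represents t wh w] /\
    [/\ homotopy r s uh vh H, homotopy s t vh wh K
      & represents (fun x : P (r + s + t).-1 =>
          aug P (H (r + s).-1 0 (wh (r + s + t).-1 (r + s).-1 x)
                 + uh r 0 (K (r + s + t).-1 r x))) m].

End Massey.

(* Main.v *)
Require Import Defs.
From HB Require Import structures.
From mathcomp Require Import all_boot all_order all_algebra all_fingroup.
From Stdlib Require Import ClassicalEpsilon.

(** Let f be the cocycle of z on a resolution M of k, lifted to a chain map Z of
    degree n, and let L be the kernel of the map Omega^n k -> k defined by f.

    Ext and Massey products.  The mapping cone of Z yields a resolution of L by
    pairs (a, b) ([fib_res]).  A class of Ext^i(L, k) is given on it by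
    h a + f' b, where f' is a cocycle of degree i + 1 and h d = f' Z: that is, by a
    class v with v z = 0 and a reason for this product to vanish.  Extend f' and h
    to a lift V of f' and a null homotopy K of V Z, and let H be a null homotopy
    of Z V with bottom component g.  Splicing with z gives the cocycle
    f V b + f K a; as f V = g d, it is a coboundary exactly when g Z + f K is a
    multiple of z up to coboundaries.  But g Z + f K represents <z, v, z>.  This is
    [semi_productive_Sq] and [Sq_semi_productive].

    Massey products and squares.  On the cochains of the standard resolution,
    Steenrod's cup-1 product gives explicit null homotopies: if d c = v z then
    d (v u_1 z + c) = z v.  The corresponding value of the Massey product is
    (v u_1 z + c) z + z c, and the Hirsch formula shows that it differs from
    v (z u_1 z) by the coboundary of c u_1 z ([massey_cochain]).  The class of
    z u_1 z is the semilinear square of degree n - 1 of the class of z, because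
    the cross terms are coboundaries of cup-2 products ([semilin_Sq_cup1]).  All the formulas for
    cup-i products come from one recursion on lists of vertices ([cobd_cupi]).

    The link.  The statement defines classes by cochains and Massey products by
    chain maps on an arbitrary resolution.  A comparison map from the standard
    resolution turns chain maps into cap products up to homotopy
    ([compare_cap]); carrying these homotopies along shows that every Massey
    product <z, v, z>, on any resolution, has the value v (z u_1 z) modulo (z)
    ([massey_val_ideal]).  Finally, the semilinear square refers to a basis of the
    cohomology over the prime field, whose existence is [F2_basis_exists]. *)

Set Implicit Arguments.
Unset Strict Implicit.
Unset Printing Implicit Defensive.
Import GRing.Theory.
Local Open Scope ring_scope.


(** * Chain maps and homotopies between resolutions *)

Section Lifting.
Variable A : pzRingType.

(** [projective] lifts along surjections only; corestricting to the kernel of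
    [q] turns exactness at [V] into such a surjection. *)
Lemma projective_lift (X U V W : lmodType A) (p : {linear U -> V})
    (q : {linear V -> W}) (c : {linear X -> V}) :
  projective X -> (forall y, q y = 0 <-> exists x, p x = y) ->
  (forall x, q (c x) = 0) -> exists h : {linear X -> U}, forall x, p (h x) = c x.
Proof.
move=> projX ex qc.
have qp x : q (p x) = 0 by apply/ex; exists x.
have [|h Hh] := projX _ _ (corestr qp) (corestr qc).
  move=> y; have /eqP qy : q (ker_val y) == 0 by have := ker_valP y.
  by have /ex[x px] := qy; exists x; apply: val_inj.
by exists h => x; have /(congr1 val) := Hh x.
Qed.

Lemma dependent_sequence (T : nat -> Type) (R : forall j, T j -> T j.+1 -> Prop)
    (x0 : T 0) :
  (forall j x, exists y, @R j x y) ->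
  exists2 f : forall j, T j, f 0 = x0 & forall j, R j (f j) (f j.+1).
Proof.
move=> step.
pose next j x := proj1_sig (constructive_indefinite_description _ (step j x)).
exists (fix f j := if j is i.+1 return T j then next i (f i) else x0) => // j.
exact: (proj2_sig (constructive_indefinite_description _ (step j _))).
Qed.

(** A map of degree [r] has components [X (j + r) -> Y j].  The second index is
    kept free, as in [graded_map], so that composites need no casts; components
    off the diagonal [i = j + r] are junk. *)
Definition graded (X Y : nat -> lmodType A) := forall i j, {linear X i -> Y j}.

Lemma graded_extend (X Y : nat -> lmodType A) (a : nat -> nat)
    (u : forall j, {linear X (a j) -> Y j}) :
  exists U : graded X Y, forall j, U (a j) j = u j.
Proof.
pose U : graded X Y := fun i j =>
  if @eqP _ (a j) i is ReflectT e then eq_rect (a j) (fun i => {linear X i -> Y j}) (u j) i e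
  else \0%R.
exists U => j; rewrite /U; case: eqP => // e.
by rewrite (eq_irrelevance e (erefl _)).
Qed.

(** With the zero map in degree 0, homotopies of chain maps of degree 0 and of
    positive degree obey the same formula. *)
Definition pdiff (N : lmodType A) (X : resolution N) i : {linear X i -> X i.-1} :=
  match i return {linear X i -> X i.-1} with
  | 0 => \0%R
  | i.+1 => diff X i
  end.

Lemma diffK (N : lmodType A) (X : resolution N) i x : diff X i (diff X i.+1 x) = 0.
Proof. by apply/diff_exact; exists x. Qed.

Lemma augK (N : lmodType A) (X : resolution N) x : aug X (diff X 0 x) = 0.
Proof. by apply/aug_exact; exists x. Qed.

Lemma pdiffK (N : lmodType A) (X : resolution N) i x : pdiff X i (diff X i x) = 0.
Proof. by case: i x => //= i x; rewrite diffK. Qed.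

Variables (N1 N2 : lmodType A) (X : resolution N1) (Y : resolution N2).

Definition chain r (u : graded X Y) := forall i j, i = (j + r)%N ->
  forall x, diff Y j (u i.+1 j.+1 x) = u i j (diff X i x).

Definition null r (u h : graded X Y) := forall i j, i = (j + r)%N ->
  forall x, u i j x = diff Y j (h i j.+1 x) + h i.-1 j (pdiff X i x).

Lemma chain_lift r (f : {linear X r -> N2}) :
  (forall x, f (diff X r x) = 0) ->
  exists2 u, chain r u & forall x, aug Y (u r 0 x) = f x.
Proof.
move=> fd.
have [u0 Hu0] := @term_projective _ _ X r _ _ (aug Y) f (@aug_surj _ _ Y).
pose T j := {u : {linear X (j + r)%N -> Y j} |
  forall x, aug_diff Y j (u (diff X (j + r) x)) = 0}.
have x0 : {u : T 0 | sval u = u0}.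
  have H x : aug_diff Y 0 (u0 (diff X (0 + r) x)) = 0 by rewrite /= Hu0 fd.
  by exists (exist _ u0 H).
pose R j (u : T j) (v : T j.+1) := forall x,
  diff Y j (sval v x) = sval u (diff X (j + r) x).
have step j (u : T j) : exists v, R j u v.
  case: u => u Hu.
  have ex y : aug_diff Y j y = 0 <-> exists x, diff Y j x = y.
    by case: j y {u Hu} => [|j] y; [apply: aug_exact | apply: diff_exact].
  have [v Hv] := projective_lift (c := u \o diff X (j + r)) (@term_projective _ _ X _) ex Hu.
  have H x : aug_diff Y j.+1 (v (diff X (j.+1 + r) x)) = 0.
    by rewrite /= Hv /= diffK linear0.
  by exists (exist _ v H).
have [u Hu0' Hu] := dependent_sequence (sval x0) step.
have [U HU] := @graded_extend X Y (fun j => j + r)%N (fun j => sval (u j)).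
exists U => [_ j -> x|x].
  by have := Hu j x; rewrite -!HU.
by have := HU 0; rewrite Hu0' (svalP x0) => ->.
Qed.

(** A chain map into a resolution is null-homotopic as soon as its bottom
    component is a coboundary.  The witness [k] of the coboundary can be kept as
    the bottom of the homotopy; this is how a homotopy is made to extend a
    cochain given beforehand. *)
Lemma null_homotopy r (u : graded X Y) (k : {linear X r.-1 -> N2}) :
  chain r u -> (forall x, aug Y (u r 0 x) = k (pdiff X r x)) ->
  exists2 h, null r u h & forall x, aug Y (h r.-1 0 x) = k x.
Proof.
move=> chu augu.
have [h0 Hh0] := @term_projective _ _ X r.-1 _ _ (aug Y) k (@aug_surj _ _ Y).
pose T j := {h : {linear X (j + r).-1 -> Y j} |
  forall x, aug_diff Y j (u (j + r)%N j x - h (pdiff X (j + r) x)) = 0}.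
have x0 : {h : T 0 | sval h = h0}.
  have H x : aug_diff Y 0 (u (0 + r)%N 0 x - h0 (pdiff X (0 + r) x)) = 0.
    by rewrite /= linearB /= Hh0 augu subrr.
  by exists (exist _ h0 H).
pose R j (h : T j) (v : T j.+1) := forall x,
  diff Y j (sval v x) = u (j + r)%N j x - sval h (pdiff X (j + r) x).
have step j (h : T j) : exists v, R j h v.
  case: h => h Hh.
  have ex y : aug_diff Y j y = 0 <-> exists x, diff Y j x = y.
    by case: j y {h Hh} => [|j] y; [apply: aug_exact | apply: diff_exact].
  have [v Hv] := projective_lift (c := u (j + r)%N j \- (h \o pdiff X (j + r)))
    (@term_projective _ _ X _) ex Hh.
  have H x : aug_diff Y j.+1 (u (j.+1 + r)%N j.+1 x - v (pdiff X (j.+1 + r) x)) = 0.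
    rewrite /= linearB /= Hv /= pdiffK linear0 subr0.
    by rewrite (chu (j + r)%N j) // subrr.
  by exists (exist _ v H).
have [h Hh0' Hh] := dependent_sequence (sval x0) step.
have [U HU] := @graded_extend X Y (fun j => (j + r).-1)%N (fun j => sval (h j)).
exists U => [_ j -> x|x].
  by have := Hh j x; rewrite -!HU => ->; rewrite subrK.
by have := HU 0; rewrite Hh0' (svalP x0) => ->.
Qed.

Lemma chain_homotopic r (u v : graded X Y) (k : {linear X r.-1 -> N2}) :
  chain r u -> chain r v ->
  (forall x, aug Y (u r 0 x) = aug Y (v r 0 x) + k (pdiff X r x)) ->
  exists2 h : graded X Y, (forall i j, i = (j + r)%N -> forall x,
      u i j x = v i j x + diff Y j (h i j.+1 x) + h i.-1 j (pdiff X i x))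
    & forall x, aug Y (h r.-1 0 x) = k x.
Proof.
move=> chu chv E.
have [||h Hh hk] := @null_homotopy r (fun i j => u i j \- v i j) k.
- by move=> i j Ei x; rewrite /= linearB chu // chv.
- by move=> x; rewrite /= linearB E addrC addKr.
exists h => // i j Ei x; rewrite -addrA -(Hh i j Ei) /=.
by rewrite addrC subrK.
Qed.

End Lifting.

Lemma chain_homotopic_id (A : pzRingType) (N : lmodType A) (X : resolution N)
    (e : forall j, {linear X j -> X j}) :
  (forall j x, diff X j (e j.+1 x) = e j (diff X j x)) ->
  (forall x, aug X (e 0 x) = aug X x) ->
  exists h : graded X X, forall j x,
    e j x = x + diff X j (h j j.+1 x) + h j.-1 j (pdiff X j x).
Proof.
move=> de ae.
have [E HE] := graded_extend e.
have [I HI] := graded_extend (a := id) (fun j => idfun : {linear X j -> X j}).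
have [|||h Hh _] := @chain_homotopic A N N X X 0 E I \0.
- by move=> i j; rewrite addn0 => -> x; rewrite !HE de.
- by move=> i j; rewrite addn0 => -> x; rewrite !HI.
- by move=> x; rewrite HE HI ae /= addr0.
by exists h => j x; have := Hh j j (esym (addn0 j)) x; rewrite HE HI.
Qed.


(** * Identities in abelian groups of exponent 2 *)

(** Two sums in such a group are equal as soon as every atom occurs in both with
    the same parity.  The tactic [char2] reifies both sides and compares
    parities. *)
Inductive c2term := C2zero | C2atom of nat | C2add of c2term & c2term | C2opp of c2term.

Fixpoint c2parity e i : bool :=
  match e with
  | C2zero => false
  | C2atom n => n == i
  | C2add a b => c2parity a i (+) c2parity b i
  | C2opp a => c2parity a i
  end.

Fixpoint c2eval (V : zmodType) (env : seq V) e : V :=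
  match e with
  | C2zero => 0
  | C2atom n => nth 0 env n
  | C2add a b => c2eval env a + c2eval env b
  | C2opp a => - c2eval env a
  end.

Definition exponent2 (V : zmodType) := forall x : V, x + x = 0.

Lemma c2eval_parity (V : zmodType) (V2 : exponent2 V) (env : seq V) a b :
  all (fun i => c2parity a i == c2parity b i) (iota 0 (size env)) ->
  c2eval env a = c2eval env b.
Proof.
have key e : c2eval env e = \sum_(i < size env) env`_i *+ c2parity e i.
  elim: e => [|m|e1 IH1 e2 IH2|e IH] /=.
  - by rewrite big1.
  - case: (ltnP m (size env)) => [lm|lm].
      rewrite (bigD1 (Ordinal lm)) //= eqxx big1 ?addr0 // => i.
      by rewrite -val_eqE /= eq_sym => /negPf->.
    by rewrite nth_default // big1 // => i _; case: eqP => // E;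
      move: lm; rewrite E leqNgt ltn_ord.
  - rewrite IH1 IH2 -big_split /=; apply: eq_bigr => i _.
    by case: (c2parity e1 i); case: (c2parity e2 i); rewrite /= ?addr0 ?add0r ?V2.
  - by rewrite IH -sumrN; apply: eq_bigr => i _; rewrite -mulNrn;
      congr (_ *+ _); apply/eqP; rewrite eq_sym -addr_eq0 V2.
move=> /allP par; rewrite !key; apply: eq_bigr => i _.
by rewrite (eqP (par i _)) // mem_iota /= ltn_ord.
Qed.

(* Atoms are identified up to conversion: the same value of a linear map can be
   written through several structures. *)
Ltac c2_lookup x env :=
  match env with
  | ?y :: _ => let _ := constr:(erefl x : x = y) in constr:(0%N)
  | _ :: ?env' => let n := c2_lookup x env' in constr:(S n)
  end.
Ltac c2_insert x env :=
  match env with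
  | _ => let n := c2_lookup x env in env
  | _ => constr:(x :: env)
  end.
Ltac c2_atoms t env :=
  lazymatch t with
  | (?a + ?b)%R => let env' := c2_atoms a env in c2_atoms b env'
  | (- ?a)%R => c2_atoms a env
  | 0%R => env
  | _ => c2_insert t env
  end.
Ltac c2_reify t env :=
  lazymatch t with
  | (?a + ?b)%R => let u := c2_reify a env in let v := c2_reify b env in constr:(C2add u v)
  | (- ?a)%R => let u := c2_reify a env in constr:(C2opp u)
  | 0%R => constr:(C2zero)
  | _ => let n := c2_lookup t env in constr:(C2atom n)
  end.
Ltac char2 V2 :=
  lazymatch goal with
  | |- @eq ?T ?l ?r =>
    let env := c2_atoms l (@nil T) in
    let env := c2_atoms r env in
    let a := c2_reify l env in
    let b := c2_reify r env in
    exact (@c2eval_parity _ V2 env a b isT)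
  end.

(** * Steenrod's cup-i products *)

Section SimplicialCochains.
Variable T : Type.

Section Valued.
Variable V : zmodType.
Implicit Types (f : seq T -> V) (B : seq T -> seq T -> V) (s t : seq T).

Fixpoint cobd f s : V :=
  if s is x :: t then f t + cobd (fun u => f (x :: u)) t else 0.

(** [cupi i.+1] is Steenrod's cup-i product of the two arguments of [B], and
    [cupi 0] takes the empty list as second argument.  The first vertex of
    the list goes either to the left factor only, or to both factors; in the
    second case the factors trade places and [i] drops by one.  An arbitrary [B],
    rather than a product of two cochains, keeps the recursion within one
    family. *)
Fixpoint cupi i B s : V :=
  if s is x :: t then
    (if i is j.+1 then cupi j (fun a b => B (x :: b) (x :: a)) t else 0)
    + cupi i (fun a b => B (x :: a) b) t
  else if i is 0 then B [::] [::] else 0.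

Lemma eq_cobd f g s : f =1 g -> cobd f s = cobd g s.
Proof. by elim: s f g => //= x s IH f g fg; rewrite fg; congr (_ + _); apply: IH => u; apply: fg. Qed.

Lemma cobdD f g s : cobd (fun u => f u + g u) s = cobd f s + cobd g s.
Proof. by elim: s f g => /= [|x s IH] f g; rewrite ?addr0 // IH addrACA. Qed.

Lemma cobd0 s : cobd (fun=> 0) s = 0.
Proof. by elim: s => //= x s ->; rewrite addr0. Qed.

Lemma eq_cupi i B B' s : B =2 B' -> cupi i B s = cupi i B' s.
Proof.
elim: s i B B' => [|x s IH] [|i] B B' BB' //=; first by rewrite (IH _ _ (fun a b => B' (x :: a) b)).
by congr (_ + _); apply: IH.
Qed.

Lemma cupiD i B B' s : cupi i (fun a b => B a b + B' a b) s = cupi i B s + cupi i B' s.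
Proof.
by elim: s i B B' => [|x s IH] [|i] B B' //=; rewrite ?addr0 // !IH ?add0r // addrACA.
Qed.

Lemma cupi_eq0 i B s :
  (forall a b, (size a + size b = size s + i)%N -> B a b = 0) -> cupi i B s = 0.
Proof.
elim: s i B => [|x s IH] [|i] B B0 //=; first exact: B0.
  by rewrite add0r IH // => a b E; apply: B0; rewrite /= addSn E.
rewrite !IH ?addr0 // => a b E; apply: B0 => /=; first by rewrite !addSn E.
by rewrite !addSn !addnS (addnC (size b)) E.
Qed.

Lemma cupi0 B s : cupi 0 B s = B s [::].
Proof. by elim: s B => //= x s IH B; rewrite IH add0r. Qed.

Lemma cupi1S B x t :
  cupi 1 B (x :: t) = B [:: x] (x :: t) + cupi 1 (fun a b => B (x :: a) b) t.
Proof. by rewrite /= cupi0. Qed.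

Lemma cupi2S B x t : cupi 2 B (x :: t) =
  cupi 1 (fun a b => B (x :: b) (x :: a)) t + cupi 2 (fun a b => B (x :: a) b) t.
Proof. by []. Qed.

Lemma cupi1E B s : cupi 1 B s = \sum_(p < size s) B (take p.+1 s) (drop p s).
Proof.
elim: s B => [|x s IH] B /=; first by rewrite big_ord0.
by rewrite big_ord_recl /= take0 cupi0 IH.
Qed.

Lemma cupi2E B s : cupi 2 B s =
  \sum_(i < size s) \sum_(j < size s | (i < j)%N)
     B (take i.+1 s ++ drop j s) (take (j - i).+1 (drop i s)).
Proof.
elim: s B => [|x s IH] B; first by rewrite big_ord0.
have -> : cupi 2 B (x :: s) = cupi 1 (fun a b => B (x :: b) (x :: a)) s
   + cupi 2 (fun a b => B (x :: a) b) s by [].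
rewrite IH cupi1E /= big_ord_recl /=; congr (_ + _).
  rewrite [RHS]big_mkcond /= big_ord_recl /= add0r; apply: eq_bigr => j _.
  by rewrite take0.
apply: eq_bigr => i _; rewrite [RHS]big_mkcond /= big_ord_recl /= add0r -big_mkcond /=.
by apply: eq_big => j; rewrite /bump /= ?add1n ?ltnS.
Qed.

Lemma cupiA (E : seq T -> seq T -> seq T -> V) s :
  cupi 1 (fun a b => cupi 1 (fun p q => E a p q) b) s =
  cupi 1 (fun c q => cupi 1 (fun a p => E a p q) c) s.
Proof.
elim: s E => // x s IH E; rewrite !cupi1S (IH (fun a => E (x :: a))).
rewrite [cupi 1 _ [::]]/= addr0 -addrA; congr (_ + _).
by rewrite -cupiD; apply: eq_cupi => a b; rewrite cupi1S.
Qed.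

(** The Hirsch formula (pq) u_1 r = p (q u_1 r) + (p u_1 r) q: the block of
    vertices given to [r] is inserted in one of the two factors of pq. *)
Lemma cupi_hirsch (D : seq T -> seq T -> seq T -> V) s :
  cupi 2 (fun c r => cupi 1 (fun p q => D p q r) c) s =
  cupi 1 (fun p c => cupi 2 (fun q r => D p q r) c) s +
  cupi 1 (fun c q => cupi 2 (fun p r => D p q r) c) s.
Proof.
elim: s D => [|x s IH] D; first by rewrite /= addr0.
pose D' p q r := D (x :: p) q r.
rewrite cupi2S !cupi1S.
rewrite (@eq_cupi 1 _ (fun a b => D [:: x] (x :: b) (x :: a) +
   cupi 1 (fun p q => D' p q (x :: a)) b)); last by move=> a b; rewrite cupi1S.
rewrite (@eq_cupi 2 _ (fun a b => D [:: x] (x :: a) b +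
   cupi 1 (fun p q => D' p q b) a)); last by move=> a b; rewrite cupi1S.
rewrite (@eq_cupi 1 (fun a b => cupi 2 (fun p r => D p b r) (x :: a)) (fun c q =>
   cupi 1 (fun a b => D' b q (x :: a)) c + cupi 2 (fun p r => D' p q r) c)); last first.
  by move=> a b; rewrite cupi2S.
rewrite !cupiD cupi2S IH [cupi 2 _ [:: x]]/= !addr0 add0r -!addrA; congr (_ + _).
by rewrite (cupiA (fun a p q => D' p q (x :: a))) [LHS]addrCA; congr (_ + _); rewrite [LHS]addrCA.
Qed.

(** The coboundary of the tensor product of two complexes, mod 2. *)
Definition bicobd B a b := cobd (B^~ b) a + cobd (B a) b.

(** Steenrod's formula: d(cup-i) differs from (cup-i) d by cup-(i-1) and its
    transpose.  The recursion treats all [i] alike, so that one induction on the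
    list of vertices proves all these formulas at once. *)
Lemma cobd_cupi (V2 : exponent2 V) i B s :
  cobd (cupi i B) s = cupi i (bicobd B) s +
    (if i is j.+1 then cupi j B s + cupi j (fun a b => B b a) s else 0).
Proof.
elim: s i B => [|x s IH] i B.
  by case: i => [|[|i]] /=; rewrite ?V2 /bicobd /= ?addr0.
have D1 a b : bicobd B (x :: a) b = B a b + bicobd (fun a b => B (x :: a) b) a b.
  by rewrite /bicobd /= addrA.
have D2 a b : bicobd B (x :: b) (x :: a) = (B b (x :: a) + B (x :: b) a) +
    bicobd (fun a b => B (x :: b) (x :: a)) a b.
  by rewrite /bicobd /=; char2 V2.
case: i => [|i].
  have -> C t : cupi 0 C (x :: t) = cupi 0 (fun a b => C (x :: a) b) t by rewrite /= add0r.
  rewrite (eq_cupi _ _ D1) cupiD -[cobd _ _]/(cupi 0 B s + cobd (fun u => cupi 0 B (x :: u)) s).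
  rewrite (@eq_cobd _ (cupi 0 (fun a b => B (x :: a) b))) ?IH ?addrA //.
  by move=> u /=; rewrite add0r.
have CS j C t : cupi j.+1 C (x :: t) = cupi j (fun a b => C (x :: b) (x :: a)) t +
   cupi j.+1 (fun a b => C (x :: a) b) t by [].
rewrite -[cobd _ _]/(cupi i.+1 B s + cobd (fun u => cupi i.+1 B (x :: u)) s).
rewrite (@eq_cobd _ (fun u => cupi i (fun a b => B (x :: b) (x :: a)) u +
   cupi i.+1 (fun a b => B (x :: a) b) u)); last by move=> u; rewrite CS.
rewrite cobdD !IH [in RHS]CS (eq_cupi _ _ D2) (eq_cupi _ _ D1) !cupiD.
case: i => [|i].
  have C0S C t : cupi 0 C (x :: t) = cupi 0 (fun a b => C (x :: a) b) t by rewrite /= add0r.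
  by rewrite !C0S; char2 V2.
by rewrite !CS; char2 V2.
Qed.

Lemma cobd_map (h : T -> T) f s : cobd f (map h s) = cobd (fun t => f (map h t)) s.
Proof. by elim: s f => //= x s IH f; rewrite IH. Qed.

Lemma cupi_map (h : T -> T) i B s :
  cupi i B (map h s) = cupi i (fun a b => B (map h a) (map h b)) s.
Proof. by elim: s i B => //= x s IH [|i] B; rewrite !IH. Qed.

Lemma cobd_eq0 f s : (forall t, (size t).+1 = size s -> f t = 0) -> cobd f s = 0.
Proof.
elim: s f => //= x s IH f f0; rewrite f0 // add0r IH // => t E.
by apply: f0; rewrite /= E.
Qed.

Lemma cobdK (V2 : exponent2 V) f s : cobd (cobd f) s = 0.
Proof.
elim: s f => //= x s IH f; rewrite cobdD IH; char2 V2.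
Qed.

Lemma cobdE f s : cobd f s = \sum_(i < size s) f (take i s ++ drop i.+1 s).
Proof.
elim: s f => [|x s IH] f; first by rewrite big_ord0.
by rewrite /= IH big_ord_recl /= drop0.
Qed.

Lemma eq_cobd_size (f g : seq T -> V) s :
  (forall t, (size t).+1 = size s -> f t = g t) -> cobd f s = cobd g s.
Proof.
elim: s f g => //= x s IH f g E; rewrite E //; congr (_ + _); apply: IH => t Et.
by apply: E; rewrite /= Et.
Qed.
End Valued.
End SimplicialCochains.

Section ValuedMore.
Variables (T : Type) (V W : zmodType).

Lemma cobd_morph (L : V -> W) (f : seq T -> V) s :
  L 0 = 0 -> {morph L : x y / x + y} -> L (cobd f s) = cobd (fun t => L (f t)) s.
Proof. by move=> L0 LD; elim: s f => //= x s IH f; rewrite LD IH. Qed.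

Lemma cupi_morph (L : V -> W) i (B : seq T -> seq T -> V) s :
  L 0 = 0 -> {morph L : x y / x + y} ->
  L (cupi i B s) = cupi i (fun a b => L (B a b)) s.
Proof.
by move=> L0 LD; elim: s i B => [|x s IH] [|i] B //=; rewrite LD ?L0 !IH.
Qed.

Lemma cobd_additive (L : {additive V -> W}) (f : seq T -> V) s :
  L (cobd f s) = cobd (fun t => L (f t)) s.
Proof. by apply: cobd_morph; [exact: raddf0 | exact: raddfD]. Qed.

Lemma cupi_additive (L : {additive V -> W}) i (B : seq T -> seq T -> V) s :
  L (cupi i B s) = cupi i (fun a b => L (B a b)) s.
Proof. by apply: cupi_morph; [exact: raddf0 | exact: raddfD]. Qed.

End ValuedMore.

Lemma linear_cobd (T : Type) (A : pzRingType) (V W : lmodType A) (L : {linear V -> W})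
  (f : seq T -> V) s : L (cobd f s) = cobd (fun t => L (f t)) s.
Proof. exact: cobd_additive. Qed.

Lemma linear_cupi (T : Type) (A : pzRingType) (V W : lmodType A) (L : {linear V -> W})
  i (B : seq T -> seq T -> V) s : L (cupi i B s) = cupi i (fun a b => L (B a b)) s.
Proof. exact: cupi_additive. Qed.


(** * Cochains in characteristic 2 *)

Section CochainAlgebra.
Variables (gT : finGroupType) (k : fieldType).
Hypothesis char_k : 2%N \in [pchar k].
Implicit Types (f h c z v : seq gT -> k) (s : seq gT).

Lemma field_exponent2 : exponent2 k.
Proof. by move=> x; rewrite addrr_pchar2. Qed.
Local Notation k2 := field_exponent2.

Lemma oppr2 (x : k) : - x = x. Proof. char2 k2. Qed.

Lemma codiffE f s : codiff f s = cobd f s.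
Proof.
rewrite cobdE; apply: eq_bigr => i _.
by rewrite oppr2 expr1n mul1r.
Qed.

Definition cup2 f h s : k := cupi 3 (fun a b => f a * h b) s.

Lemma cupE f h s : cup f h s = cupi 1 (fun a b => f a * h b) s.
Proof. by rewrite cupi1E. Qed.

Lemma cup1E f h s : cup1 f h s = cupi 2 (fun a b => f a * h b) s.
Proof. by rewrite cupi2E. Qed.

Lemma eq_cup f f' h h' s : f =1 f' -> h =1 h' -> cup f h s = cup f' h' s.
Proof. by move=> ff hh; rewrite !cupE; apply: eq_cupi => a b; rewrite ff hh. Qed.

Lemma eq_cup1 f f' h h' s : f =1 f' -> h =1 h' -> cup1 f h s = cup1 f' h' s.
Proof. by move=> ff hh; rewrite !cup1E; apply: eq_cupi => a b; rewrite ff hh. Qed.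

Lemma eq_codiff f f' s : f =1 f' -> codiff f s = codiff f' s.
Proof. by move=> ff; rewrite !codiffE; apply: eq_cobd. Qed.

Lemma codiffD f f' s : codiff (fun s => f s + f' s) s = codiff f s + codiff f' s.
Proof. by rewrite !codiffE cobdD. Qed.

Lemma codiffZ a f s : codiff (fun s => a * f s) s = a * codiff f s.
Proof. by rewrite !codiffE !cobdE mulr_sumr. Qed.

Lemma codiffK f s : codiff (codiff f) s = 0.
Proof. by rewrite codiffE (eq_cobd _ (codiffE f)) cobdK //; apply: k2. Qed.

Lemma cupDl f f' h s : cup (fun s => f s + f' s) h s = cup f h s + cup f' h s.
Proof. by rewrite !cupE -cupiD; apply: eq_cupi => a b; rewrite mulrDl. Qed.

Lemma cupDr f h h' s : cup f (fun s => h s + h' s) s = cup f h s + cup f h' s.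
Proof. by rewrite !cupE -cupiD; apply: eq_cupi => a b; rewrite mulrDr. Qed.

Lemma cup1Dl f f' h s : cup1 (fun s => f s + f' s) h s = cup1 f h s + cup1 f' h s.
Proof. by rewrite !cup1E -cupiD; apply: eq_cupi => a b; rewrite mulrDl. Qed.

Lemma cup1Dr f h h' s : cup1 f (fun s => h s + h' s) s = cup1 f h s + cup1 f h' s.
Proof. by rewrite !cup1E -cupiD; apply: eq_cupi => a b; rewrite mulrDr. Qed.

Lemma cupi_mul0l i f h s : (forall s, f s = 0) -> cupi i (fun a b => f a * h b) s = 0.
Proof. by move=> f0; apply: cupi_eq0 => a b _; rewrite f0 mul0r. Qed.

Lemma cupi_mul0r i f h s : (forall s, h s = 0) -> cupi i (fun a b => f a * h b) s = 0.
Proof. by move=> h0; apply: cupi_eq0 => a b _; rewrite h0 mulr0. Qed.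

Lemma cupA f g h s : cup (cup f g) h s = cup f (cup g h) s.
Proof.
rewrite !cupE.
rewrite (@eq_cupi _ _ 1 (fun a b => cup f g a * h b)
  (fun a b => cupi 1 (fun p q => f p * g q * h b) a)); last first.
  by move=> a b; rewrite /cup mulr_suml cupi1E.
rewrite (@eq_cupi _ _ 1 (fun a b => f a * cup g h b)
  (fun a b => cupi 1 (fun p q => f a * g p * h q) b)); last first.
  by move=> a b; rewrite /cup mulr_sumr cupi1E; apply: eq_bigr => i _; rewrite mulrA.
by rewrite -(cupiA (fun a p q => f a * g p * h q)).
Qed.

Lemma cup1_cupl f g h s :
  cup1 (cup f g) h s = cup f (cup1 g h) s + cup (cup1 f h) g s.
Proof.
rewrite cup1E.
rewrite (@eq_cupi _ _ 2 (fun a b => cup f g a * h b)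
  (fun a r => cupi 1 (fun p q => f p * g q * h r) a)); last first.
  by move=> a b; rewrite /cup mulr_suml cupi1E.
rewrite (cupi_hirsch (fun p q r => f p * g q * h r)) !cupE; congr (_ + _);
  apply: eq_cupi => a b; rewrite cup1E !cupi2E ?mulr_sumr ?mulr_suml; apply: eq_bigr => i _;
  rewrite ?mulr_sumr ?mulr_suml; apply: eq_bigr => j _; first by rewrite mulrA.
by rewrite mulrAC.
Qed.

Lemma bicobd_mul f h a b :
  bicobd (fun a b => f a * h b) a b = codiff f a * h b + f a * codiff h b.
Proof.
by rewrite /bicobd !codiffE !cobdE mulr_suml mulr_sumr.
Qed.

Lemma codiff_cupi i f h s :
  codiff (cupi i.+1 (fun a b => f a * h b)) s =
  cupi i.+1 (fun a b => codiff f a * h b) s + cupi i.+1 (fun a b => f a * codiff h b) s +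
  (cupi i (fun a b => f a * h b) s + cupi i (fun a b => h a * f b) s).
Proof.
rewrite codiffE (cobd_cupi k2); congr (_ + (_ + _)).
  by rewrite -cupiD; apply: eq_cupi => a b; rewrite bicobd_mul.
by apply: eq_cupi => a b; rewrite mulrC.
Qed.

Lemma codiff_cup f h s : cochain f -> cochain h ->
  codiff (cup f h) s = cup (codiff f) h s + cup f (codiff h) s.
Proof.
move=> [f0 _ _] [h0 _ _]; rewrite (eq_codiff _ (cupE f h)) codiff_cupi -!cupE.
by rewrite !cupi0 f0 h0 !mulr0 !addr0.
Qed.

Lemma codiff_cup1 f h s :
  codiff (cup1 f h) s = cup1 (codiff f) h s + cup1 f (codiff h) s + (cup f h s + cup h f s).
Proof. by rewrite (eq_codiff _ (cup1E f h)) codiff_cupi -!cup1E -!cupE. Qed.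

Lemma codiff_cup2 f h s :
  codiff (cup2 f h) s = cup2 (codiff f) h s + cup2 f (codiff h) s + (cup1 f h s + cup1 h f s).
Proof. by rewrite codiff_cupi -!cup1E. Qed.

Lemma cup0l f h s : (forall s, f s = 0) -> cup f h s = 0.
Proof. by move=> f0; rewrite cupE cupi_mul0l. Qed.
Lemma cup0r f h s : (forall s, h s = 0) -> cup f h s = 0.
Proof. by move=> f0; rewrite cupE cupi_mul0r. Qed.
Lemma cup10l f h s : (forall s, f s = 0) -> cup1 f h s = 0.
Proof. by move=> f0; rewrite cup1E cupi_mul0l. Qed.
Lemma cup10r f h s : (forall s, h s = 0) -> cup1 f h s = 0.
Proof. by move=> f0; rewrite cup1E cupi_mul0r. Qed.

Lemma eq_cochain f f' : f =1 f' -> cochain f -> cochain f'.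
Proof.
move=> ff [f0 fG [N fN]]; split; first by rewrite -ff.
  by move=> g s; rewrite -!ff.
by exists N => s; rewrite -ff; apply: fN.
Qed.

Lemma cochain0 : cochain (fun _ : seq gT => 0 : k).
Proof. by split=> //; exists 0%N. Qed.

Lemma cochainD f f' : cochain f -> cochain f' -> cochain (fun s => f s + f' s).
Proof.
move=> [f0 fG [N fN]] [h0 hG [M hM]]; split; first by rewrite f0 h0 addr0.
  by move=> g s; rewrite fG hG.
exists (maxn N M) => s; rewrite gtn_max => /andP[lN lM].
by rewrite fN // hM // addr0.
Qed.

Lemma cochainZ a f : cochain f -> cochain (fun s => a * f s).
Proof.
move=> [f0 fG [N fN]]; split; first by rewrite f0 mulr0.
  by move=> g s; rewrite fG.
by exists N => s lN; rewrite fN // mulr0.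
Qed.

Lemma cochain_codiff f : cochain f -> cochain (codiff f).
Proof.
move=> [f0 fG [N fN]]; split; first by rewrite codiffE.
  by move=> g s; rewrite !codiffE cobd_map; apply: eq_cobd => t; rewrite fG.
exists N.+1 => s lN; rewrite codiffE cobd_eq0 // => t E; apply: fN.
by rewrite -ltnS E.
Qed.

Lemma cochain_cupi i f h : cochain f -> cochain h ->
  cochain (cupi i.+1 (fun a b => f a * h b)).
Proof.
move=> [_ fG [N fN]] [_ hG [M hM]]; split=> //.
  by move=> g s; rewrite cupi_map; apply: eq_cupi => a b; rewrite fG hG.
exists (N + M)%N => s lNM; apply: cupi_eq0 => a b E.
have [la|la] := ltnP N (size a); first by rewrite fN ?mul0r.
rewrite hM ?mulr0 //; rewrite ltnNge; apply: contraL lNM => lb.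
rewrite -leqNgt; apply: leq_trans (leq_add la lb); rewrite E leq_addr //.
Qed.

Lemma cochain_cup f h : cochain f -> cochain h -> cochain (cup f h).
Proof. by move=> cf ch; apply: eq_cochain (cochain_cupi 0 cf ch) => s; rewrite cupE. Qed.

Lemma cochain_cup1 f h : cochain f -> cochain h -> cochain (cup1 f h).
Proof. by move=> cf ch; apply: eq_cochain (cochain_cupi 1 cf ch) => s; rewrite cup1E. Qed.

Lemma cochain_cup2 f h : cochain f -> cochain h -> cochain (cup2 f h).
Proof. exact: cochain_cupi. Qed.

Lemma cohP f h : (exists2 c, cochain c & forall s, f s = h s + codiff c s) ->
  cohomologous f h.
Proof. by case=> c cc E; exists c => // s; rewrite E addrAC subrr add0r. Qed.

Lemma cohE f h : cohomologous f h ->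
  exists2 c, cochain c & forall s, f s = h s + codiff c s.
Proof. by case=> c cc E; exists c => // s; rewrite -E addrC subrK. Qed.

Lemma eq_coh f h : f =1 h -> cohomologous f h.
Proof.
move=> E; apply: cohP; exists (fun=> 0); first exact: cochain0.
by move=> s; rewrite codiffE cobd0 addr0.
Qed.

Lemma coh_sym f h : cohomologous f h -> cohomologous h f.
Proof.
by case/cohE=> c cc E; apply: cohP; exists c => // s; rewrite E; char2 k2.
Qed.

Lemma cohD f f' h h' : cohomologous f h -> cohomologous f' h' ->
  cohomologous (fun s => f s + f' s) (fun s => h s + h' s).
Proof.
case/cohE=> c cc E /cohE[c' cc' E']; apply: cohP.
exists (fun s => c s + c' s); first exact: cochainD.
by move=> s; rewrite E E' codiffD; char2 k2.
Qed.

Lemma coh_trans f g h : cohomologous f g -> cohomologous g h -> cohomologous f h.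
Proof.
case/cohE=> c cc E /cohE[c' cc' E']; apply: cohP.
exists (fun s => c s + c' s); first exact: cochainD.
by move=> s; rewrite E E' codiffD; char2 k2.
Qed.

Lemma cocycleP f : cocycle f -> cochain f. Proof. by case. Qed.

Lemma eq_cocycle f f' : f =1 f' -> cocycle f -> cocycle f'.
Proof.
move=> ff [cf df]; split; first exact: eq_cochain ff cf.
by move=> s; rewrite -(eq_codiff _ ff).
Qed.

Lemma cocycleD f f' : cocycle f -> cocycle f' -> cocycle (fun s => f s + f' s).
Proof.
move=> [cf df] [cf' df']; split; first exact: cochainD.
by move=> s; rewrite codiffD df df' addr0.
Qed.

Lemma cocycleZ a f : cocycle f -> cocycle (fun s => a * f s).
Proof.
by move=> [cf df]; split; [exact: cochainZ | move=> s; rewrite codiffZ df mulr0].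
Qed.

Lemma cocycle0 : cocycle (fun _ : seq gT => 0 : k).
Proof. by split; [exact: cochain0 | move=> s; rewrite codiffE cobd0]. Qed.

Lemma cocycle_sum I (r : seq I) (F : I -> seq gT -> k) :
  (forall i, cocycle (F i)) -> cocycle (fun s => \sum_(i <- r) F i s).
Proof.
move=> cF; elim: r => [|i r IH].
  by apply: eq_cocycle cocycle0 => s; rewrite big_nil.
by apply: eq_cocycle (cocycleD (cF i) IH) => s; rewrite big_cons.
Qed.

Lemma ideal_coh z f f' : cohomologous f f' -> in_ideal z f' -> in_ideal z f.
Proof. by move=> ff [x cx fx]; exists x => //; apply: coh_trans fx. Qed.

Lemma idealD z f f' : in_ideal z f -> in_ideal z f' -> in_ideal z (fun s => f s + f' s).
Proof.
move=> [x cx fx] [y cy fy]; exists (fun s => x s + y s); first exact: cocycleD.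
by apply: coh_trans (cohD fx fy) (eq_coh _) => s; rewrite cupDl.
Qed.

Lemma ideal0 z : in_ideal z (fun=> 0).
Proof.
exists (fun=> 0); first exact: cocycle0.
by apply: eq_coh => s; rewrite cup0l.
Qed.

Lemma coh_cupl f f' h : cohomologous f f' -> cocycle h ->
  cohomologous (cup f h) (cup f' h).
Proof.
move=> /cohE[c cc E] [ch dh]; apply: cohP; exists (cup c h); first exact: cochain_cup.
by move=> s; rewrite codiff_cup // (cup0r c s dh) addr0 -cupDl; apply: eq_cup.
Qed.

Lemma coh_cupr f f' h : cohomologous f f' -> cocycle h ->
  cohomologous (cup h f) (cup h f').
Proof.
move=> /cohE[c cc E] [ch dh]; apply: cohP; exists (cup h c); first exact: cochain_cup.
by move=> s; rewrite codiff_cup // (cup0l c s dh) add0r -cupDr; apply: eq_cup.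
Qed.

(** The commutator of two cocycles is the coboundary of their cup-1 product. *)
Lemma coh_cupC f h : cocycle f -> cocycle h -> cohomologous (cup f h) (cup h f).
Proof.
move=> [cf df] [ch dh]; apply: cohP; exists (cup1 f h); first exact: cochain_cup1.
by move=> s; rewrite codiff_cup1 (cup10l h s df) (cup10r f s dh); char2 k2.
Qed.

(** The value on cochains of any Massey product <z, v, z>.  Here a and z are
    cohomologous, d c = v z and d H = a v.  As d(v u_1 z) = v z + z v, the cochain
    H + b v + v u_1 z + c is a cocycle, so that H may be replaced by v u_1 z + c
    at the cost of a multiple of z.  The coboundary of c u_1 z, computed by the
    Hirsch formula, then trades (v u_1 z) z + c z + z c for v (z u_1 z).  The
    term a eps accounts for the freedom in the other null homotopy. *)
Lemma massey_cochain z v a b c H eps :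
  cocycle z -> cocycle v -> cochain b -> cochain c -> cochain H -> cocycle eps ->
  (forall s, a s = z s + codiff b s) -> (forall s, codiff c s = cup v z s) ->
  (forall s, codiff H s = cup a v s) ->
  in_ideal z (fun s => cup H z s + cup a c s + cup a eps s + cup v (cup1 z z) s).
Proof.
move=> [cz dz] [cv dv] cb cc cH [ce de] Ea Ec EH.
exists (fun s => H s + cup b v s + cup1 v z s + c s + eps s).
  split.
    by do !apply: cochainD => //; [apply: cochain_cup|apply: cochain_cup1].
  move=> s; rewrite !codiffD codiff_cup // codiff_cup1 EH Ec de.
  rewrite (eq_cup _ Ea (frefl v)) cupDl (cup0r b _ dv) (cup10l _ _ dv) (cup10r _ _ dz).
  char2 k2.
apply: cohP.
exists (fun s => cup b c s + cup1 c z s + cup1 z eps s + cup b eps s).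
  by do !apply: cochainD => //; (apply: cochain_cup || apply: cochain_cup1).
move=> s; rewrite !codiffD !codiff_cup // !codiff_cup1.
rewrite (cup10l eps s dz) (cup10r z s de) (cup0r b s de) (cup10r c s dz).
rewrite (eq_cup s (frefl b) Ec) (eq_cup1 s Ec (frefl z)) cup1_cupl.
rewrite !(eq_cup _ Ea (frefl _)) !cupDl (cupA b).
char2 k2.
Qed.

(** On a cocycle of degree n this represents Sq^(n-1). *)
Definition sq f := cup1 f f.

(** The cross terms are the coboundary of the cup-2 product. *)
Lemma sqD f h : cocycle f -> cocycle h ->
  cohomologous (sq (fun s => f s + h s)) (fun s => sq f s + sq h s).
Proof.
move=> [cf df] [ch dh]; apply: cohP; exists (cup2 f h); first exact: cochain_cup2.
move=> s; rewrite /sq cup1Dl !cup1Dr codiff_cup2 /cup2 cupi_mul0l // cupi_mul0r //.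
char2 k2.
Qed.

(** If f = h + d c, the cross terms are the coboundary of the cup-2 product of h
    and d c, and the square of d c is that of c u_1 d c + c c. *)
Lemma sq_coh f h : cocycle h -> cohomologous f h -> cohomologous (sq f) (sq h).
Proof.
move=> [ch dh] /cohE[c cc E]; apply: cohP.
exists (fun s => cup2 h (codiff c) s + cup1 c (codiff c) s + cup c c s).
  have cdc := cochain_codiff cc.
  by do 2?apply: cochainD; [apply: cochain_cup2|apply: cochain_cup1|apply: cochain_cup].
move=> s; rewrite !codiffD codiff_cup2 codiff_cup1 codiff_cup // /cup2 (cupi_mul0l 3 (codiff c) s dh).
rewrite (cupi_mul0r 3 h s (codiffK c)) (cup10r c s (codiffK c)).
rewrite /sq (eq_cup1 s E E) cup1Dl !cup1Dr; char2 k2.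
Qed.

Lemma sq_sum I (r : seq I) (F : I -> seq gT -> k) : (forall i, cocycle (F i)) ->
  cohomologous (sq (fun s => \sum_(i <- r) F i s)) (fun s => \sum_(i <- r) sq (F i) s).
Proof.
move=> cF; elim: r => [|i r IH].
  by apply: eq_coh => s; rewrite big_nil /sq cup10l // => t; rewrite big_nil.
apply: coh_trans (eq_coh _) (coh_trans (sqD (cF i) (cocycle_sum r cF)) _).
  by move=> s; apply: eq_cup1 => t; rewrite big_cons.
apply: coh_trans (cohD (eq_coh (frefl _)) IH) (eq_coh _) => s; by rewrite big_cons.
Qed.

Lemma F2_inclD (a b : 'F_2) : F2_incl k (a + b) = F2_incl k a + F2_incl k b.
Proof.
have E : (1 + 1 = 0 :> k) by exact: k2.
rewrite /F2_incl; case: a => -[|[|//]] ?; case: b => -[|[|//]] ? /=;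
  by rewrite ?addr0 ?add0r ?E.
Qed.

Lemma F2_inclM (a b : 'F_2) : F2_incl k (a * b) = F2_incl k a * F2_incl k b.
Proof.
rewrite /F2_incl; case: a => -[|[|//]] ?; case: b => -[|[|//]] ? /=;
  by rewrite ?mulr0 ?mul0r ?mulr1.
Qed.

Lemma F2_incl_sum I (r : seq I) (P : pred I) (F : I -> 'F_2) :
  F2_incl k (\sum_(i <- r | P i) F i) = \sum_(i <- r | P i) F2_incl k (F i).
Proof. by apply: (big_morph _ F2_inclD). Qed.

Lemma F2_incl_codiff (u : seq gT -> 'F_2) s :
  codiff (fun s => F2_incl k (u s)) s = F2_incl k (codiff u s).
Proof.
rewrite codiffE cobdE F2_incl_sum; apply: eq_bigr => i _.
by have -> : (-1 : 'F_2) = 1; [apply/val_inj | rewrite expr1n mul1r].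
Qed.

Lemma F2_incl_cochain (u : seq gT -> 'F_2) :
  cochain u -> cochain (fun s => F2_incl k (u s)).
Proof.
move=> [u0 uG [N uN]]; split; first by rewrite u0.
  by move=> g s; rewrite uG.
by exists N => s /uN ->.
Qed.

Lemma F2_incl_cocycle (u : seq gT -> 'F_2) :
  cocycle u -> cocycle (fun s => F2_incl k (u s)).
Proof.
by move=> [cu du]; split; [exact: F2_incl_cochain | move=> s; rewrite F2_incl_codiff du].
Qed.

Lemma F2_incl_Sq (u : seq gT -> 'F_2) s :
  F2_incl k (Sq_pred u s) = sq (fun s => F2_incl k (u s)) s.
Proof.
rewrite /Sq_pred /sq /cup1 F2_incl_sum; apply: eq_bigr => i _.
by rewrite F2_incl_sum; apply: eq_bigr => j _; rewrite F2_inclM.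
Qed.

Lemma sqZ a f s : sq (fun s => a * f s) s = a ^+ 2 * sq f s.
Proof.
rewrite /sq /cup1 mulr_sumr; apply: eq_bigr => i _; rewrite mulr_sumr.
by apply: eq_bigr => j _; rewrite mulrACA.
Qed.

Lemma lin_comb_cocycle m (l : 'I_m -> k) (u : 'I_m -> seq gT -> 'F_2) :
  (forall i, cocycle (u i)) -> cocycle (lin_comb l u).
Proof.
by move=> cu; apply: cocycle_sum => i; apply/cocycleZ/F2_incl_cocycle.
Qed.

Lemma sq_lin_comb m (l : 'I_m -> k) (u : 'I_m -> seq gT -> 'F_2) z :
  (forall i, cocycle (u i)) -> cohomologous z (lin_comb l u) ->
  cohomologous (lin_comb (fun i => l i ^+ 2) (fun i => Sq_pred (u i))) (sq z).
Proof.
move=> cu zE; apply: coh_sym.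
apply: coh_trans (sq_coh (lin_comb_cocycle l cu) zE) (coh_trans (sq_sum _ _) (eq_coh _)).
  by move=> i; apply/cocycleZ/F2_incl_cocycle.
by move=> s; apply: eq_bigr => i _; rewrite sqZ F2_incl_Sq.
Qed.

(** Squaring a linear combination of cocycles u_i squares its coefficients, up
    to cross terms that are coboundaries; so the semilinear square of the class
    of z is the class of z u_1 z, whatever the basis. *)
Lemma semilin_Sq_cup1 n z w : semilin_Sq n z w -> cohomologous w (cup1 z z).
Proof.
case=> m [u [l [[cu _] zE wE]]]; apply: coh_trans wE (sq_lin_comb _ zE).
by move=> i; case: (cu i).
Qed.

Definition part d f s := if size s == d.+1 then f s else 0.

Lemma part_cochain d f : cochain f -> cochain (part d f).
Proof.
move=> [f0 fG _]; split=> //; first by move=> g s; rewrite /part size_map fG.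
exists d.+1 => s; rewrite /part; case: eqP => // ->; by rewrite ltnn.
Qed.

Lemma codiff_part d f s : cochain f ->
  codiff (part d f) s = if size s == d.+2 then codiff f s else 0.
Proof.
move=> [f0 _ _]; rewrite !codiffE.
case: eqP => E; last first.
  by rewrite cobd_eq0 // => t Et; rewrite /part; case: eqP => // E'; case: E; rewrite -Et E'.
have := E; rewrite -[d.+2]addn1 => _.
rewrite !cobdE; apply: eq_bigr => i _; rewrite /part.
have -> : size (face i s) = d.+1; last by rewrite eqxx.
rewrite /face size_cat size_takel ?size_drop; last exact: ltnW.
by apply: succn_inj; rewrite -addnS -subSn // subSS subnKC // ltnW.
Qed.

Lemma part_cocycle d f : cocycle f -> cocycle (part d f).
Proof.
move=> [cf df]; split; first exact: part_cochain.
by move=> s; rewrite codiff_part // df; case: ifP.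
Qed.

Lemma part_homog d f : homog d (part d f).
Proof. by move=> s /negPf E; rewrite /part E. Qed.

Lemma part_id d f : homog d f -> part d f =1 f.
Proof. by move=> hf s; rewrite /part; case: ifPn => // /hf. Qed.

Lemma cup_homogr n j f h s : homog n h -> size s = (j + n).+1 ->
  cup f h s = f (take j.+1 s) * h (drop j s).
Proof.
move=> hh Es; have lj : (j < size s)%N by rewrite Es ltnS leq_addr.
rewrite /cup (bigD1 (Ordinal lj)) //= big1 ?addr0 // => i.
rewrite -val_eqE /= => ne; rewrite hh ?mulr0 // size_drop; apply: contra ne => /eqP E.
by have := subnKC (ltnW (ltn_ord i)); rewrite E -(eqn_add2r n.+1) => ->; rewrite Es addnS.
Qed.

Lemma cup_part n d v z s : homog n z -> cup (part d v) z s = part (d + n) (cup v z) s.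
Proof.
move=> hz; rewrite /cup /part.
have -> (b : bool) (x : k) : (if b then x else 0) = x *+ b by case: b.
rewrite -sumrMnl; apply: eq_bigr => p _.
have [E|ne] := eqVneq (size (drop p s)) n.+1; last by rewrite hz // !mulr0 mul0rn.
have -> : (size s == (d + n).+1) = (size (take p.+1 s) == d.+1).
  move: E; rewrite size_takel // size_drop eqSS -addnS => E.
  by rewrite -{1}(subnKC (ltnW (ltn_ord p))) E eqn_add2r.
by case: eqP => _; rewrite ?mul0r.
Qed.

Lemma part_sum f : cochain f -> exists N, forall s, f s = \sum_(d < N) part d f s.
Proof.
move=> [f0 _ [N fN]]; exists N => s.
case: s => [|x s]; first by rewrite f0 big1 // => d _; rewrite /part.
rewrite /part; have [lN|lN] := ltnP (size s) N.
  rewrite (bigD1 (Ordinal lN)) //= eqxx big1 ?addr0 // => d.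
  by rewrite -val_eqE /= eqSS eq_sym => /negPf ->.
by rewrite fN // big1 // => d _; case: ifP.
Qed.

Lemma codiff_part_homog d c f : (0 < d)%N -> homog d f -> cochain c ->
  (forall s, f s = codiff c s) -> forall s, f s = codiff (part d.-1 c) s.
Proof.
case: d => // d _ hf cc E s; rewrite codiff_part //.
by case: ifPn => [_|/hf]; rewrite E.
Qed.

Lemma homog_cup d n v z : homog d v -> homog n z -> homog (d + n) (cup v z).
Proof.
move=> hv hz s ne; rewrite -(eq_cup s (part_id hv) (frefl z)) (cup_part _ _ _ hz).
by rewrite /part (negPf ne).
Qed.

End CochainAlgebra.


(** * The standard resolution *)

Section StandardResolution.
Variables (gT : finGroupType) (k : fieldType).
Local Notation kG := (grpalg gT k).
Local Notation kk := (trivmod gT k : lmodType kG).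
Local Notation act g s := [seq (g%g * x)%g | x <- s].

(** The scalar c of k as an element of the group algebra. *)
Definition ksc (c : k) : kG := [ffun x => c * (x == 1%g)%:R].

Lemma ksc_mulE c (a : kG) x : (ksc c * a) x = c * a x.
Proof.
rewrite ffunE (bigD1 1%g) //= ffunE eqxx mulr1 invg1 mul1g big1 ?addr0 // => y.
by move/negPf => ne; rewrite ffunE ne mulr0 mul0r.
Qed.

Lemma kscC c (a : kG) : a * ksc c = ksc c * a.
Proof.
apply/ffunP=> x; rewrite ksc_mulE ffunE (bigD1 x) //= ffunE mulVg eqxx mulr1 mulrC.
rewrite big1 ?addr0 // => y /negPf ny.
by rewrite ffunE -eq_mulVg1 ny !mulr0.
Qed.

Lemma kscM c c' : ksc (c * c') = ksc c * ksc c'.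
Proof. by apply/ffunP=> x; rewrite ksc_mulE !ffunE mulrA. Qed.

Lemma ksc_is_additive : zmod_morphism ksc.
Proof. by move=> c c'; apply/ffunP=> x; rewrite !ffunE mulrBl. Qed.
HB.instance Definition _ := GRing.isZmodMorphism.Build k kG ksc ksc_is_additive.

Lemma ksc1 : ksc 1 = 1.
Proof. by apply/ffunP=> x; rewrite !ffunE mul1r. Qed.

Lemma ksc_scale_cobd (V : lmodType kG) (f : seq gT -> k) (x : V) s :
  ksc (cobd f s) *: x = cobd (fun t => ksc (f t) *: x) s.
Proof.
apply: (cobd_morph (L := fun c => ksc c *: x)); first by rewrite raddf0 scale0r.
by move=> c c'; rewrite raddfD scalerDl.
Qed.

Lemma ksc_scale_cupi (V : lmodType kG) i (B : seq gT -> seq gT -> k) (x : V) s :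
  ksc (cupi i B s) *: x = cupi i (fun a b => ksc (B a b) *: x) s.
Proof.
apply: (cupi_morph (L := fun c => ksc c *: x)); first by rewrite raddf0 scale0r.
by move=> c c'; rewrite raddfD scalerDl.
Qed.

Lemma ksc_triv c (x : kk) : ksc c *: x = (c * x : k).
Proof.
rewrite /GRing.scale /= /triv_scale (bigD1 1%g) //= ffunE eqxx mulr1.
by rewrite big1 ?addr0 // => g /negPf ng; rewrite ffunE ng mulr0.
Qed.

Lemma grp_elt_triv g (x : kk) : grp_elt k g *: x = x.
Proof.
rewrite /GRing.scale /= /triv_scale (bigD1 g) //= ffunE eqxx.
by rewrite big1 ?addr0 ?mul1r // => h /negPf ng; rewrite ffunE ng.
Qed.

Lemma grp_elt_mulE g (a : kG) x : (grp_elt k g * a) x = a (g^-1 * x)%g.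
Proof.
rewrite ffunE (bigD1 g) //= ffunE eqxx mul1r big1 ?addr0 // => y /negPf ny.
by rewrite ffunE ny mul0r.
Qed.

Lemma grp_eltM (g h : gT) : grp_elt k g * grp_elt k h = grp_elt k (g * h)%g.
Proof.
by apply/ffunP=> x; rewrite grp_elt_mulE !ffunE -(inj_eq (mulgI g)) mulKVg.
Qed.

Lemma grpalg_sum (a : kG) : a = \sum_g ksc (a g) * grp_elt k g.
Proof.
apply/ffunP=> x; rewrite sum_ffunE (bigD1 x) //= big1 ?addr0.
  by rewrite ksc_mulE ffunE eqxx mulr1.
by move=> y ny; rewrite ksc_mulE ffunE eq_sym (negPf ny) mulr0.
Qed.

(** The degree n term of the standard resolution, as the free module on the
    lists [1; g_1; ...; g_n]. *)
Definition std n : lmodType kG := {ffun n.-tuple gT -> kG^o}.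
Coercion std_fun n (F : std n) : {ffun n.-tuple gT -> kG^o} := F.

(** The basis element attached to a list [g_0; ...; g_n], which is
    g_0 [1; g_0^-1 g_1; ...; g_0^-1 g_n], and 0 for a list of another length. *)
Definition bas n (s : seq gT) : std n :=
  [ffun t : n.-tuple gT =>
     (if s is g :: s' then if act g^-1 s' == t then grp_elt k g else 0 else 0) : kG^o]
  : {ffun n.-tuple gT -> kG^o}.

Lemma std_sumE n I (r : seq I) (P : pred I) (F : I -> std n) t :
  (\sum_(i <- r | P i) F i) t = \sum_(i <- r | P i) F i t.
Proof.
by apply: (big_morph (fun F : std n => F t)) => [x y|]; rewrite ffunE.
Qed.

Lemma bas_size n s : size s != n.+1 -> bas n s = 0.
Proof.
case: s => [|g s] ns; apply/ffunP=> t; rewrite !ffunE //.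
case: eqP => // E; move: ns => /=; rewrite eqSS.
by rewrite -(size_map (mulg g^-1)%g) E size_tuple eqxx.
Qed.

Lemma bas_act n g s : grp_elt k g *: bas n s = bas n (act g s).
Proof.
apply/ffunP=> t; rewrite !ffunE; case: s => [|h s] /=; first by rewrite scaler0.
have -> : act (g * h)^-1 (act g s) = act h^-1 s.
  by rewrite -map_comp; apply: eq_map => x /=; rewrite invMg -mulgA mulKg.
by case: eqP => _; rewrite ?scaler0 // -[LHS]/(grp_elt k g * _) grp_eltM.
Qed.

Section Extension.
Variables (V : lmodType kG) (n : nat).

Definition free_ext (phi : n.-tuple gT -> V) (F : std n) : V := \sum_t F t *: phi t.

Fact free_ext_linear phi : linear (free_ext phi).
Proof.
move=> a F F'; rewrite /free_ext scaler_sumr -big_split /=; apply: eq_bigr => t _.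
by rewrite !ffunE scalerDl scalerA.
Qed.
HB.instance Definition _ phi :=
  GRing.isLinear.Build kG (std n) V *:%R (free_ext phi) (free_ext_linear phi).

(** The linear extension of an equivariant function on lists.  It is sealed
    because simplification would expand it into a sum. *)
Definition lext (phi : seq gT -> V) : {linear std n -> V} :=
  locked (free_ext (fun t => phi (1%g :: t)) : {linear std n -> V}).

Lemma eq_lext (phi phi' : seq gT -> V) F :
  (forall s, size s = n.+1 -> phi s = phi' s) -> lext phi F = lext phi' F.
Proof.
move=> E; rewrite /lext -!lock; apply: eq_bigr => t _; rewrite E //=.
by rewrite size_tuple.
Qed.

Lemma lextE (phi : seq gT -> V) s :
  (forall g s, phi (act g s) = grp_elt k g *: phi s) -> size s = n.+1 ->
  lext phi (bas n s) = phi s.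
Proof.
move=> phiG; case: s => // g s [Es]; rewrite /lext -lock /= /free_ext.
have Et : size (act g^-1%g s) == n by rewrite size_map Es.
rewrite (bigD1 (Tuple Et)) //= big1 ?addr0 => [|t ne].
  rewrite ffunE eqxx -phiG /= mulg1 -map_comp map_id_in // => x _ /=.
  by rewrite mulKVg.
rewrite ffunE; case: eqP => [E|_]; last by rewrite scale0r.
by case/eqP: ne; apply: val_inj.
Qed.

(** The extension to a k-linear map of an arbitrary function on lists; it
    serves for the contracting homotopy, which is not equivariant. *)
Definition kext (phi : seq gT -> V) (F : std n) : V :=
  \sum_t \sum_g ksc (F t g) *: phi (g :: act g t).

Fact kext_additive phi : zmod_morphism (kext phi).
Proof.
move=> F F'; rewrite /kext -sumrB; apply: eq_bigr => t _; rewrite -sumrB.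
by apply: eq_bigr => g _; rewrite !ffunE raddfB scalerBl.
Qed.
HB.instance Definition _ phi :=
  GRing.isZmodMorphism.Build (std n) V (kext phi) (kext_additive phi).

Lemma kextZ phi c F : kext phi (ksc c *: F) = ksc c *: kext phi F.
Proof.
rewrite /kext scaler_sumr; apply: eq_bigr => t _; rewrite scaler_sumr.
apply: eq_bigr => g _; rewrite ffunE scalerA -kscM.
by rewrite -[(ksc c *: F t) g]/((ksc c * F t) g) ksc_mulE.
Qed.

Lemma kext_bas phi s : size s = n.+1 -> kext phi (bas n s) = phi s.
Proof.
case: s => // g s [Es]; rewrite /kext.
have Et : size (act g^-1%g s) == n by rewrite size_map Es.
rewrite (bigD1 (Tuple Et)) //= [X in _ + X]big1 ?addr0 => [|t ne].
  rewrite (bigD1 g) //= big1 ?addr0 => [|h ne].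
    rewrite !ffunE eqxx ffunE eqxx ksc1 scale1r -map_comp map_id_in // => x _ /=.
    by rewrite mulKVg.
  by rewrite ffunE eqxx ffunE (negPf ne) raddf0 scale0r.
apply: big1 => h _; rewrite ffunE; case: eqP => [E|_].
  by case/eqP: ne; apply: val_inj.
by rewrite ffunE raddf0 scale0r.
Qed.

End Extension.

Lemma kext_self n (F : std n) : F = kext (bas n) F.
Proof.
rewrite /kext; apply/ffunP => t; rewrite std_sumE (bigD1 t) //= [X in _ + X]big1 ?addr0.
  rewrite std_sumE {1}(grpalg_sum (F t)); apply: eq_bigr => g _.
  rewrite !ffunE -map_comp map_id_in ?eqxx // => x _ /=; first by rewrite mulKg.
move=> u ne; rewrite std_sumE big1 // => g _; rewrite !ffunE.
have -> : act g^-1 (act g u) = u.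
  by rewrite -map_comp map_id_in // => x _ /=; rewrite mulKg.
by rewrite val_eqE (negPf ne) scaler0.
Qed.

Lemma kext_comp (V W : lmodType kG) n (L : {additive V -> W}) phi (F : std n) :
  (forall c x, L (ksc c *: x) = ksc c *: L x) ->
  L (kext phi F) = kext (fun s => L (phi s)) F.
Proof.
move=> LZ; rewrite /kext raddf_sum; apply: eq_bigr => t _; rewrite raddf_sum.
by apply: eq_bigr => g _; rewrite LZ.
Qed.

Lemma linear_kext (V W : lmodType kG) n (L : {linear V -> W}) phi (F : std n) :
  L (kext phi F) = kext (fun s => L (phi s)) F.
Proof. by apply: (kext_comp (L := L)) => c x; apply: linearZ. Qed.

Lemma eq_kext (V : lmodType kG) n (phi psi : seq gT -> V) (F : std n) :
  (forall s, size s = n.+1 -> phi s = psi s) -> kext phi F = kext psi F.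
Proof.
move=> E; apply: eq_bigr => t _; apply: eq_bigr => g _; rewrite E //=.
by rewrite size_map size_tuple.
Qed.

Lemma kextD (V : lmodType kG) n (phi psi : seq gT -> V) (F : std n) :
  kext (fun s => phi s + psi s) F = kext phi F + kext psi F.
Proof.
rewrite -big_split; apply: eq_bigr => t _; rewrite -big_split; apply: eq_bigr => g _.
by rewrite scalerDr.
Qed.

Lemma std_eq (V : lmodType kG) n (L L' : {linear std n -> V}) :
  (forall s, size s = n.+1 -> L (bas n s) = L' (bas n s)) -> forall F, L F = L' F.
Proof.
move=> E F; by rewrite [F]kext_self !linear_kext; apply: eq_kext.
Qed.

Lemma std_free n (F : std n) : F = \sum_t F t *: bas n (1%g :: t).
Proof.
apply/ffunP=> t; rewrite std_sumE (bigD1 t) //= big1 ?addr0.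
  rewrite !ffunE map_id_in ?eqxx => [|x _ /=]; last by rewrite invg1 mul1g.
  by rewrite -[RHS]/(_ * 1) mulr1.
move=> u ne; rewrite !ffunE map_id_in => [|x _ /=]; last by rewrite invg1 mul1g.
by rewrite val_eqE (negPf ne) scaler0.
Qed.

Lemma std_projective n : projective (std n).
Proof.
move=> M N p f psurj.
have [phi Hphi] := fin_all_exists (fun t : n.-tuple gT => psurj (f (bas n (1%g :: t)))).
exists (free_ext phi) => F; rewrite [in RHS](std_free F) /= /free_ext !linear_sum.
by apply: eq_bigr => t _; rewrite (linearZZ p) (linearZZ f) Hphi.
Qed.

Lemma std_fin_gen n : fin_gen (std n).
Proof.
pose tv (i : 'I_#|{: n.-tuple gT}|) : n.-tuple gT := enum_val i.
exists #|{: n.-tuple gT}|, (fun i => bas n (1%g :: tv i)) => F.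
exists (fun i => F (tv i)); rewrite [LHS]std_free.
rewrite (reindex tv) /=; last first.
  by apply: onW_bij; exists enum_rank; [exact: enum_valK | exact: enum_rankK].
by apply: eq_bigl.
Qed.

End StandardResolution.


Section StandardComplex.
Variables (gT : finGroupType) (k : fieldType).
Local Notation kG := (grpalg gT k).
Local Notation kk := (trivmod gT k : lmodType kG).
Local Notation act g s := [seq (g%g * x)%g | x <- s].
Local Notation std := (std gT k).
Local Notation bas := (@bas gT k).
Hypothesis char_k : 2%N \in [pchar k].
Local Notation k2 := (field_exponent2 char_k).

Lemma module_exponent2 (V : lmodType kG) : exponent2 V.
Proof.
move=> x; rewrite -[x]scale1r -scalerDl -ksc1 -raddfD /=.
by rewrite (k2 1) raddf0 scale0r.
Qed.

Lemma grpalg_oppr1 : -1 = 1 :> kG.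
Proof. by rewrite -[RHS]ksc1 -[1 : kG]ksc1 -raddfN /= oppr2. Qed.

Lemma cobd_act (V : lmodType kG) (phi : seq gT -> V) g s :
  (forall g s, phi (act g s) = grp_elt k g *: phi s) ->
  cobd phi (act g s) = grp_elt k g *: cobd phi s.
Proof.
move=> phiG; rewrite cobd_map (eq_cobd _ (phiG g)).
by rewrite (cobd_additive (GRing.scale (grp_elt k g))).
Qed.

Definition std_diff n : {linear std n.+1 -> std n} := lext n.+1 (cobd (bas n)).

Lemma std_diffE n s : std_diff n (bas n.+1 s) = cobd (bas n) s.
Proof.
have [E|ne] := eqVneq (size s) n.+2.
  by apply: lextE => // g t; apply: cobd_act => h u; rewrite bas_act.
rewrite bas_size // linear0 cobd_eq0 // => t E; apply: bas_size.
by apply: contra ne; rewrite -E.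
Qed.

Definition std_aug : {linear std 0 -> kk} := @lext gT k kk 0 (fun=> (1 : k)).

Lemma std_augE s : size s = 1%N -> std_aug (bas 0 s) = (1 : k).
Proof. by move=> E; rewrite lextE // => g t; rewrite grp_elt_triv. Qed.

Lemma std_diffK n F : std_diff n (std_diff n.+1 F) = 0.
Proof.
apply: (std_eq (L := std_diff n \o std_diff n.+1) (L' := \0)) => s Es /=.
rewrite std_diffE linear_cobd (eq_cobd _ (std_diffE n)).
exact/cobdK/module_exponent2.
Qed.

Lemma std_augK F : std_aug (std_diff 0 F) = 0.
Proof.
apply: (std_eq (L := std_aug \o std_diff 0) (L' := \0)) => s Es /=.
rewrite std_diffE linear_cobd; case: s Es => [|x [|y [|? ?]]] // _ /=.
by rewrite !std_augE // addr0; apply: k2.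
Qed.

Definition std_contract n : std n -> std n.+1 := kext (fun s => bas n.+1 (1%g :: s)).
HB.instance Definition _ n := GRing.Additive.on (@std_contract n).

Lemma std_contractE n s : std_contract (bas n s) = bas n.+1 (1%g :: s).
Proof.
have [E|ne] := eqVneq (size s) n.+1; first exact: kext_bas.
by rewrite !bas_size ?raddf0.
Qed.

Lemma std_diff_exact n F : std_diff n F = 0 <-> exists H, std_diff n.+1 H = F.
Proof.
split=> [F0|[H <-]]; last exact: std_diffK.
exists (std_contract F).
have : std_diff n.+1 (std_contract F) + std_contract (std_diff n F) = F.
  rewrite [RHS]kext_self {2}[F]kext_self {1}/std_contract !linear_kext.
  rewrite (kext_comp (L := @std_contract n)) => [|c x]; last exact: kextZ.
  rewrite -kextD; apply: eq_kext => s Es.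
  rewrite !std_diffE (cobd_additive (@std_contract n)) /=.
  by rewrite (eq_cobd _ (@std_contractE n)) -addrA module_exponent2 addr0.
by rewrite F0 raddf0 addr0.
Qed.

Lemma std_aug_exact F : std_aug F = 0 <-> exists H, std_diff 0 H = F.
Proof.
split=> [F0|[H <-]]; last exact: std_augK.
exists (std_contract F); rewrite linear_kext.
rewrite (eq_kext (psi := fun s => bas 0 s + bas 0 [:: 1%g])) => [|s Es].
  rewrite kextD -kext_self -[RHS]addr0; congr (_ + _).
  transitivity (ksc gT (std_aug F) *: bas 0 [:: 1%g]); last by rewrite F0 raddf0 scale0r.
  rewrite [in RHS](kext_self F) linear_kext.
  rewrite /kext !raddf_sum scaler_suml; apply: eq_bigr => t _.
  rewrite !raddf_sum scaler_suml; apply: eq_bigr => g _.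
  by rewrite std_augE /= ?size_map ?size_tuple // ksc_triv mulr1.
rewrite std_diffE; case: s Es => [|x [|]] // _ /=.
by rewrite addr0.
Qed.

Lemma std_aug_surj y : exists F, std_aug F = y.
Proof.
exists (ksc gT y *: bas 0 [:: 1%g]); rewrite (linearZZ std_aug) std_augE //.
by rewrite ksc_triv mulr1.
Qed.

Definition std_res : resolution kk :=
  Resolution (@std_projective gT k) (@std_fin_gen gT k) std_aug_surj
    std_aug_exact std_diff_exact.

(** * Cap products *)

(** The cap product with h sends the list s to h(tail of s) times the front of s.
    Composing a cochain f with it gives the cup product of f and h, so that the
    cap product with a cocycle is a chain map that represents its class. *)
Definition capfun (h : seq gT -> k) j s : std j :=
  cupi 1 (fun a b => ksc gT (h b) *: bas j a) s.

(** Sealed, since comparing two cap products by unfolding them is slow. *)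
Fact cap_subproof (h : seq gT -> k) :
  {c : graded std std | c = fun i j => lext i (capfun h j)}.
Proof. by exists (fun i j => lext i (capfun h j)). Qed.

Definition cap h : graded std std := sval (cap_subproof h).

Lemma cap_def h : cap h = fun i j => lext i (capfun h j).
Proof. exact: svalP (cap_subproof h). Qed.

Definition invariant_cochain (h : seq gT -> k) := forall g s, h (act g s) = h s.

Lemma capfun_act h j g s : invariant_cochain h ->
  capfun h j (act g s) = grp_elt k g *: capfun h j s.
Proof.
move=> hG; rewrite /capfun cupi_map (cupi_additive (GRing.scale (grp_elt k g))).
by apply: eq_cupi => a b; rewrite hG -bas_act scalerA -kscC -scalerA.
Qed.

Lemma capE h i j s : invariant_cochain h -> size s = i.+1 ->
  cap h i j (bas i s) = capfun h j s.
Proof. by move=> hG Es; rewrite cap_def; apply: lextE => // g t; apply: capfun_act. Qed.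

Lemma capfun_size h r j s : homog r h -> size s != (j + r).+1 -> capfun h j s = 0.
Proof.
move=> hh ne; apply: cupi_eq0 => a b E.
have [Ea|/bas_size->] := eqVneq (size a) j.+1; last by rewrite scaler0.
rewrite hh ?raddf0 ?scale0r //; apply: contra ne => /eqP Eb.
by move: E; rewrite Ea Eb addn1 addSn addnS => -[->].
Qed.

(** Steenrod's formula for i = 0, with values in the resolution itself. *)
Lemma cap_boundary h i j x : cochain h ->
  std_diff j (cap h i.+1 j.+1 x) + cap h i j (std_diff i x) =
  cap (codiff h) i.+1 j x.
Proof.
move=> ch; have [h0 hG _] := ch; have [_ dhG _] := cochain_codiff char_k ch.
apply: (std_eq (L := (std_diff j \o cap h i.+1 j.+1) \+ (cap h i j \o std_diff i))
   (L' := cap (codiff h) i.+1 j)) => s Es /=.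
rewrite std_diffE !capE // linear_cobd.
rewrite (eq_cobd_size (g := capfun h j)) => [|t Et]; last first.
  by apply: capE => //; apply: succn_inj; rewrite Et.
rewrite (cobd_cupi (@module_exponent2 _)) !cupi0 h0 raddf0 scale0r.
rewrite (@bas_size gT k _ [::]) // scaler0 !addr0 /capfun.
rewrite linear_cupi -cupiD; apply: eq_cupi => a b.
rewrite (linearZZ (std_diff j)) std_diffE /bicobd.
rewrite -(cobd_additive (GRing.scale (ksc gT (h b)))) addrA module_exponent2 add0r.
by rewrite codiffE // ksc_scale_cobd.
Qed.

(** Associativity of the cup product. *)
Lemma cap_comp v w r j i x : homog r v -> invariant_cochain v -> invariant_cochain w ->
  cap v (j + r)%N j (cap w i (j + r)%N x) = cap (cup v w) i j x.
Proof.
move=> hv vG wG.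
apply: (std_eq (L := cap v (j + r)%N j \o cap w i (j + r)%N)) => s Es /=.
rewrite !capE //; last first.
  by move=> g t; rewrite !cupE cupi_map; apply: eq_cupi => a b; rewrite vG wG.
rewrite /capfun linear_cupi.
pose E (a p q : seq gT) := ksc gT (v p * w q) *: bas j a.
rewrite [RHS](@eq_cupi _ _ 1 _ (fun a b => cupi 1 (fun p q => E a p q) b)); last first.
  move=> a b; rewrite cupE.
  by rewrite ksc_scale_cupi.
rewrite (cupiA E); apply: eq_cupi => a b; rewrite (linearZZ (cap v _ _)).
have [Ea|ne] := eqVneq (size a) (j + r).+1.
  rewrite capE // /capfun (cupi_additive (GRing.scale (ksc gT (w b)))).
  by apply: eq_cupi => p q; rewrite /= scalerA -kscM mulrC.
rewrite bas_size // linear0 scaler0 /E.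
rewrite (@eq_cupi _ _ 1 _ (fun p q => ksc gT (w b) *: (ksc gT (v q) *: bas j p))); last first.
  by move=> p q; rewrite scalerA -kscM mulrC.
by rewrite -(cupi_additive (GRing.scale (ksc gT (w b)))) -/(capfun v j a) (capfun_size hv ne) raddf0.
Qed.

Lemma linear_capfun h j (f : {linear std j -> kk}) s :
  f (capfun h j s) = cup (fun t => f (bas j t)) h s.
Proof.
rewrite cupE /capfun linear_cupi; apply: eq_cupi => a b.
by rewrite (linearZZ f) ksc_triv mulrC.
Qed.

Lemma std_aug_cap h i s : invariant_cochain h -> size s = i.+1 ->
  std_aug (cap h i 0 (bas i s)) = h s.
Proof.
move=> hG Es; rewrite capE // /capfun cupi1E raddf_sum.
case: s Es => // x s Es; rewrite big_ord_recl big1 ?addr0 => [|p _].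
  by rewrite /= (linearZZ std_aug) take0 std_augE // ksc_triv mulr1.
rewrite bas_size ?scaler0 ?raddf0 //= size_takel //.
Qed.

End StandardComplex.


(** * Cohomology classes on an arbitrary resolution *)

Section Dictionary.
Variables (gT : finGroupType) (k : fieldType).
Local Notation kG := (grpalg gT k).
Local Notation kk := (trivmod gT k : lmodType kG).
Local Notation act g s := [seq (g%g * x)%g | x <- s].
Local Notation std := (std gT k).
Local Notation bas := (@bas gT k).
Hypothesis char_k : 2%N \in [pchar k].
Local Notation k2 := (field_exponent2 char_k).
Local Notation S := (std_res gT char_k).

Definition coch n (f : {linear std n -> kk}) (s : seq gT) : k := f (bas n s).

Lemma coch_cochain n (f : {linear std n -> kk}) : cochain (coch f).
Proof.
split; first by rewrite /coch bas_size // linear0.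
  by move=> g s; rewrite /coch -bas_act (linearZZ f) grp_elt_triv.
by exists n.+1 => s ls; rewrite /coch bas_size ?linear0 // neq_ltn ls orbT.
Qed.

Lemma coch_homog n (f : {linear std n -> kk}) : homog n (coch f).
Proof. by move=> s ns; rewrite /coch bas_size // linear0. Qed.

Lemma coch_diff n (f : {linear std n -> kk}) s :
  codiff (coch f) s = f (std_diff gT k n (bas n.+1 s)).
Proof. by rewrite codiffE // std_diffE linear_cobd. Qed.

Definition lin n (z : seq gT -> k) : {linear std n -> kk} := @lext gT k kk n z.
Arguments lin : clear implicits.

Lemma coch_lin n z : invariant_cochain z -> homog n z -> coch (lin n z) =1 z.
Proof.
move=> zG hz s; rewrite /coch; have [E|ne] := eqVneq (size s) n.+1.
  by rewrite /lin lextE // => g t; rewrite zG grp_elt_triv.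
by rewrite bas_size // linear0 hz.
Qed.

(** Functionals that differ by a coboundary of the resolution have cohomologous
    cochains, and conversely ([pdiff_coh]). *)
Lemma coh_pdiff n (f g : {linear std n -> kk}) (h : {linear std n.-1 -> kk}) :
  (forall x, f x = g x + h (pdiff S n x)) -> cohomologous (coch f) (coch g).
Proof.
move=> E; case: n f g h E => [|n] f g h E.
  by apply: eq_coh => // s; rewrite /coch E /= linear0 addr0.
apply: cohP; exists (coch h); first exact: coch_cochain.
by move=> s; rewrite coch_diff /coch E.
Qed.

Lemma pdiff_coh n (f g : {linear std n -> kk}) :
  cohomologous (coch f) (coch g) ->
  exists h : {linear std n.-1 -> kk}, forall x, f x = g x + h (pdiff S n x).
Proof.
case/cohE=> c cc E; case: n f g E => [|n] f g E.
  exists \0 => x; rewrite /= addr0; apply: std_eq => s Es; move: (E s).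
  have [c0 _ _] := cc.
  by rewrite codiffE // /coch => ->; case: s Es => [|x' []] //= _; rewrite c0 !addr0.
exists (lin n (part n c)) => x.
apply: (std_eq (L' := g \+ (lin n (part n c) \o pdiff S n.+1))) => s Es /=.
rewrite -[f _]/(coch f s) E; congr (_ + _).
rewrite -coch_diff; have [c0 cG _] := part_cochain n cc.
rewrite (eq_codiff char_k _ (coch_lin cG (@part_homog _ _ n c))).
by rewrite codiff_part // Es eqxx.
Qed.

Lemma coch_cocycle n (f : {linear std n -> kk}) :
  (forall x, f (std_diff gT k n x) = 0) -> cocycle (coch f).
Proof. by move=> fd; split; [exact: coch_cochain | move=> s; rewrite coch_diff fd]. Qed.

Lemma lin_cocycle n z : cocycle z -> homog n z ->
  forall x, lin n z (std_diff gT k n x) = 0.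
Proof.
move=> [[_ zG _] dz] hz; apply: (std_eq (L := lin n z \o std_diff gT k n) (L' := \0)) => s Es /=.
by rewrite -coch_diff (eq_codiff char_k _ (coch_lin zG hz)).
Qed.

Lemma cap_bas h r i j s : invariant_cochain h -> homog r h -> i = (j + r)%N ->
  cap h i j (bas i s) = capfun h j s.
Proof.
move=> hG hh Ei; have [E|ne] := eqVneq (size s) i.+1; first exact: capE.
by rewrite bas_size // linear0 (capfun_size (r := r)) // -Ei.
Qed.

Lemma coch_cap h r i j (f : {linear std j -> kk}) s :
  invariant_cochain h -> homog r h -> i = (j + r)%N ->
  f (cap h i j (bas i s)) = cup (coch f) h s.
Proof. by move=> hG hh Ei; rewrite (cap_bas s hG hh Ei) linear_capfun. Qed.

Lemma aug_cap h r x : invariant_cochain h -> homog r h ->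
  std_aug gT k (cap h r 0 x) = lin r h x.
Proof.
move=> hG hh; apply: (std_eq (L := std_aug gT k \o cap h r 0)) => s Es /=.
by rewrite std_aug_cap // -/(coch (lin r h) s) coch_lin.
Qed.

Lemma cap_cocycle h i j x : cocycle h ->
  std_diff gT k j (cap h i.+1 j.+1 x) = cap h i j (std_diff gT k i x).
Proof.
move=> [ch dh]; have := @cap_boundary _ _ char_k h i j x ch.
have -> : cap (codiff h) i.+1 j x = 0.
  apply: (std_eq (L' := \0)) => s Es; rewrite capE //.
    by apply: cupi_eq0 => a b _; rewrite dh raddf0 scale0r.
  by have [] := cochain_codiff char_k ch.
by move=> E; rewrite -[LHS]addr0 -(module_exponent2 char_k (cap h i j (std_diff gT k i x)))
   addrA E add0r.
Qed.

(** In degree [j = 0] this says that the cap product with a cochain of degree r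
    vanishes on boundaries of degree r - 1. *)
Lemma cap_pdiff h r i j x : cocycle h -> homog r h -> i.+1 = (j + r)%N ->
  pdiff S j (cap h i.+1 j x) = cap h i j.-1 (std_diff gT k i x).
Proof.
move=> ch hh Ei; case: j Ei => [|j] Ei; last exact: cap_cocycle.
rewrite /= ; have [[_ hG _] _] := ch.
apply/esym; apply: (std_eq (L := cap h i 0 \o std_diff gT k i) (L' := \0)) => s Es /=.
rewrite std_diffE linear_cobd cobd_eq0 // => t Et.
rewrite capE //; last by apply: succn_inj; rewrite Et.
by apply: capfun_size hh _; rewrite -Ei neq_ltn -ltnS Et Es leqnn.
Qed.

Variable X : resolution kk.

Definition std_comparison (psi : graded std X) :=
  (forall j x, diff X j (psi j.+1 j.+1 x) = psi j j (std_diff gT k j x)) /\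
  (forall x, aug X (psi 0 0 x) = std_aug gT k x).

Lemma exists_std_comparison : exists psi, std_comparison psi.
Proof.
have [psi cpsi apsi] := @chain_lift _ _ _ S X 0 (std_aug gT k) (@std_augK _ _ char_k).
by exists psi; split=> // j x; rewrite (cpsi j j) // addn0.
Qed.

Lemma comparison_psi psi : std_comparison psi -> comparison (fun n s => psi n n (bas n s)).
Proof.
move=> [dpsi apsi]; split.
- by move=> n g s Es; rewrite -bas_act linearZZ.
- by move=> g; rewrite apsi std_augE.
move=> n s Es; rewrite dpsi std_diffE linear_cobd cobdE Es; apply: eq_bigr => i _.
by rewrite grpalg_oppr1 // expr1n scale1r.
Qed.

Lemma comparison_lin psi : comparison psi ->
  exists2 Psi, std_comparison Psi & forall n s, size s = n.+1 -> psi n s = Psi n n (bas n s).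
Proof.
move=> [psiG psi0 psid].
have [Psi HPsi] := @graded_extend _ std X id (fun n => lext n (psi n)).
have psiE n s : size s = n.+1 -> psi n s = Psi n n (bas n s).
  (* [lextE] asks for equivariance on all lists, hence the truncation *)
  move=> Es; rewrite HPsi.
  pose phi t := if size t == n.+1 then psi n t else 0.
  have <- : lext n phi (bas n s) = lext n (psi n) (bas n s).
    by apply: eq_lext => t Et; rewrite /phi Et eqxx.
  rewrite lextE // /phi ?Es ?eqxx // => g t; rewrite size_map.
  by case: eqP => [/psiG //|_]; rewrite scaler0.
exists Psi => //; split.
  move=> j; apply: (std_eq (L := diff X j \o Psi j.+1 j.+1) (L' := Psi j j \o std_diff gT k j)).
  move=> s Es /=; rewrite -psiE // psid // std_diffE linear_cobd cobdE.
  rewrite grpalg_oppr1 // Es; apply: eq_bigr => i _; rewrite expr1n scale1r psiE //.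
  rewrite /face size_cat size_takel ?size_drop; last by rewrite Es ltnW.
  by rewrite Es subSS subnKC // -ltnS.
apply: (std_eq (L := aug X \o Psi 0 0)) => -[|g []] //= _.
by rewrite -psiE // psi0 std_augE.
Qed.

Variable psi : graded std X.
Hypothesis Hpsi : std_comparison psi.

(** The pullback of a functional on [X n] to the standard resolution.  It induces
    a bijection between the cohomology of [X] and that of cochains: see
    [classes_surjective] and [classes_injective], which use a comparison map in
    the other direction. *)
Definition pull n (f : {linear X n -> kk}) : {linear std n -> kk} := f \o psi n n.

Lemma psi_pdiff n x : pdiff X n (psi n n x) = psi n.-1 n.-1 (pdiff S n x).
Proof. by case: Hpsi => dpsi _; case: n x => [|n] x /=; [rewrite linear0 | apply: dpsi]. Qed.

Lemma pull_cocycle n (f : {linear X n -> kk}) : hom_cocycle f ->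
  forall x, pull f (std_diff gT k n x) = 0.
Proof. by case: Hpsi => dpsi _ fd x; rewrite /= -dpsi fd. Qed.

Lemma pull_cohomologous n (f g : {linear X n -> kk}) (h : {linear X n.-1 -> kk}) :
  (forall x, f x = g x + h (pdiff X n x)) ->
  cohomologous (coch (pull f)) (coch (pull g)).
Proof.
by move=> E; apply: (coh_pdiff (h := pull h)) => x; rewrite /= E psi_pdiff.
Qed.

(** Two comparison maps are homotopic, so that one of them decides which
    cochains a cocycle represents. *)
Lemma representsP n (f : {linear X n -> kk}) z : hom_cocycle f ->
  represents f z <-> cohomologous z (coch (pull f)).
Proof.
move=> fd; split=> [[phi /comparison_lin [Phi [dPhi aPhi] phiE] zE]|zE]; last first.
  exists (fun n s => psi n n (bas n s)); first exact: comparison_psi.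
  apply: (coh_trans char_k zE); apply: eq_coh => // s; case: eqP => // /eqP ne.
  by rewrite /coch bas_size // linear0.
apply: (coh_trans char_k zE).
have [dpsi apsi] := Hpsi.
have [|||h Hh _] := @chain_homotopic _ _ _ S X 0 Phi psi \0.
- by move=> i j; rewrite addn0 => -> x; rewrite dPhi.
- by move=> i j; rewrite addn0 => -> x; rewrite dpsi.
- by move=> x; rewrite aPhi apsi /= addr0.
apply: (coh_trans char_k (eq_coh char_k (h := coch (f \o Phi n n)) _) (coh_pdiff (h := f \o h n.-1 n) _)).
  move=> s; case: eqP => [Es|/eqP ne]; first by rewrite phiE.
  by rewrite /coch bas_size // linear0.
by move=> x; rewrite /= (Hh n n) ?addn0 // !linearD fd addr0.
Qed.

Lemma classes_surjective n z : cocycle z -> homog n z ->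
  exists2 f : {linear X n -> kk}, hom_cocycle f & cohomologous z (coch (pull f)).
Proof.
move=> cz hz; have [dpsi apsi] := Hpsi.
have [chi dchi achi] := @chain_lift _ _ _ X S 0 (aug X) (@augK _ _ X).
exists (lin n z \o chi n n) => [x|] /=.
  by rewrite -(dchi n n) ?addn0 //; apply: lin_cocycle.
have [||h Hh] := @chain_homotopic_id _ _ S (fun j => chi j j \o psi j j).
- by move=> j x; rewrite /= (dchi j j) ?addn0 // dpsi.
- by move=> x; rewrite /= achi apsi.
have [[_ zG _] _] := cz.
apply: (coh_trans char_k (eq_coh char_k (h := coch (lin n z)) _)).
  by move=> s; rewrite coch_lin.
apply: coh_sym => //; apply: (coh_pdiff (h := lin n z \o h n.-1 n)) => x.
by rewrite /= [chi _ _ _]Hh !linearD /= lin_cocycle // addr0.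
Qed.

Lemma classes_injective n (f g : {linear X n -> kk}) :
  hom_cocycle f -> hom_cocycle g -> cohomologous (coch (pull f)) (coch (pull g)) ->
  exists h : {linear X n.-1 -> kk}, forall x, f x = g x + h (pdiff X n x).
Proof.
move=> fd gd /pdiff_coh[h0 Hh0]; have [dpsi apsi] := Hpsi.
have [chi dchi achi] := @chain_lift _ _ _ X S 0 (aug X) (@augK _ _ X).
have [||h Hh] := @chain_homotopic_id _ _ X (fun j => psi j j \o chi j j).
- by move=> j x; rewrite /= -(dchi j j) ?addn0 // dpsi.
- by move=> x; rewrite /= apsi achi.
have chip x : pdiff S n (chi n n x) = chi n.-1 n.-1 (pdiff X n x).
  by case: n x {f g fd gd h0 Hh0} => [|n] x /=; rewrite ?linear0 // -(dchi n n) ?addn0.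
exists ((h0 \o chi n.-1 n.-1) \+ (f \o h n.-1 n) \+ (g \o h n.-1 n)) => x.
have /= := Hh0 (chi n n x); have /= -> := Hh n x.
rewrite !linearD /= fd gd !addr0 chip => E.
have M := module_exponent2 char_k (V := kk).
rewrite -[LHS]addr0 -(M (f (h n.-1 n (pdiff X n x)))) addrA E.
char2 M.
Qed.

End Dictionary.


(** * Massey products *)

Section Transfer.
Variables (gT : finGroupType) (k : fieldType).
Local Notation kG := (grpalg gT k).
Local Notation kk := (trivmod gT k : lmodType kG).
Local Notation std := (std gT k).
Local Notation bas := (@bas gT k).
Hypothesis char_k : 2%N \in [pchar k].
Local Notation k2 := (field_exponent2 char_k).
Local Notation S := (std_res gT char_k).
Let M2 (V : lmodType kG) : exponent2 V := module_exponent2 char_k (V := V).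
Variables (X : resolution kk) (psi : graded std X).
Hypothesis Hpsi : std_comparison psi.
Local Notation pull := (pull psi).

Lemma chain_mapE r (u : graded_map X) : chain_map r u <-> chain r u.
Proof.
have E (V : lmodType kG) (y : V) : (-1) ^+ r *: y = y.
  by rewrite grpalg_oppr1 // expr1n scale1r.
by split=> H i j Ei x; have := H i j Ei x; rewrite E.
Qed.

(** The cocycle whose class is that of the chain map u. *)
Definition top r (u : graded X X) : {linear X r -> kk} := aug X \o u r 0.

Lemma top_cocycle r u : chain r u -> hom_cocycle (top r u).
Proof. by move=> cu x; rewrite /= -(cu r 0) // augK. Qed.

Lemma eq_represents n (f g : X n -> kk) z : f =1 g -> represents f z -> represents g z.
Proof.
move=> E [phi cphi zE]; exists phi => //; apply: (coh_trans char_k zE).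
by apply: eq_coh => // s; case: eqP; rewrite ?E.
Qed.

Lemma chain_representsP r (u : graded X X) z :
  chain_represents r u z <-> chain r u /\ cohomologous z (coch (pull (top r u))).
Proof.
split=> -[cu H].
  have {}cu : chain r u by apply/chain_mapE.
  by split=> //; apply/(representsP char_k Hpsi z (top_cocycle cu)).
by split; [apply/chain_mapE | apply/(representsP char_k Hpsi z (top_cocycle cu))].
Qed.

(** A chain map is determined up to homotopy by its class, so along a comparison
    map it is homotopic to the cap product with any cocycle of that class. *)
Lemma compare_cap r (u : graded X X) z : cocycle z -> homog r z ->
  chain r u -> cohomologous z (coch (pull (top r u))) ->
  exists Y : graded std X, forall i j, i = (j + r)%N -> forall x,
    u i j (psi i i x) = psi j j (cap z i j x) + diff X j (Y i j.+1 x)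
      + Y i.-1 j (pdiff S i x).
Proof.
move=> cz hz cu zu; have [dpsi apsi] := Hpsi; have [[_ zG _] _] := cz.
have /(pdiff_coh char_k)[h0 Hh0] : cohomologous (coch (pull (top r u))) (coch (lin r z)).
  apply: coh_sym => //; apply: (coh_trans char_k (eq_coh char_k _) zu).
  exact: coch_lin.
have [|||Y HY _] := @chain_homotopic _ _ _ S X r (fun i j => u i j \o psi i i)
  (fun i j => psi j j \o cap z i j) h0.
- by move=> i j Ei x; rewrite /= cu // dpsi.
- by move=> i j Ei x; rewrite /= dpsi cap_cocycle.
- by move=> x; rewrite /= apsi aug_cap // -Hh0.
by exists Y.
Qed.

(** By [compare_cap], since a cochain composed with a cap product is a cup
    product. *)
Lemma product_class p r (f : {linear X p -> kk}) (u : graded X X) z :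
  hom_cocycle f -> cocycle z -> homog r z ->
  chain r u -> cohomologous z (coch (pull (top r u))) ->
  cohomologous (coch (pull (f \o u (p + r)%N p))) (cup (coch (pull f)) z).
Proof.
move=> fd cz hz cu zu; have [Y HY] := compare_cap cz hz cu zu.
have [[_ zG _] _] := cz.
have E : cohomologous (coch (pull (f \o u (p + r)%N p)))
    (coch (pull f \o cap z (p + r)%N p)).
  apply: (coh_pdiff (char_k := char_k) (h := f \o Y (p + r).-1 p)) => x.
  by rewrite /= HY // !linearD fd addr0.
apply: (coh_trans char_k E); apply: eq_coh => // s.
by rewrite -(coch_cap _ _ zG hz (erefl (p + r)%N)).
Qed.

Lemma eq_cap (h h' : seq gT -> k) i j (x : std i) : h =1 h' -> cap h i j x = cap h' i j x.
Proof.
by move=> E; rewrite !cap_def; apply: eq_lext => s _; apply: eq_cupi => a b; rewrite E.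
Qed.

(** Since d K + K d = vh wh, and vh and wh are homotopic to cap products with v
    and z through Z and Y, the map K + Z cap_z + vh Y is a null homotopy of the cap
    product with v z = d c along psi.  The cap product with c is another one, and
    the difference of the two is a chain map. *)
Lemma transfer_chain n s r z v c (vh wh : graded X X) (K : graded_map X)
    (Y Z : graded std X) :
  cocycle z -> homog n z -> cocycle v -> homog s v -> cochain c ->
  (forall t, codiff c t = cup v z t) -> r.+1 = (s + n)%N ->
  chain s vh -> homotopy s n vh wh K ->
  (forall i j, i = (j + n)%N -> forall x,
    wh i j (psi i i x) = psi j j (cap z i j x) + diff X j (Y i j.+1 x)
      + Y i.-1 j (pdiff S i x)) ->
  (forall i j, i = (j + s)%N -> forall x,
    vh i j (psi i i x) = psi j j (cap v i j x) + diff X j (Z i j.+1 x)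
      + Z i.-1 j (pdiff S i x)) ->
  @chain _ _ _ S X r (fun i j => (K i j \o psi i i) \+ (Z (j + s).-1 j \o cap z i (j + s).-1)
    \+ (vh (j + s)%N j \o Y i (j + s)%N) \+ (psi j j \o cap c i j)).
Proof.
move=> cz hz cv hv cc dc Er cvh HK HY HZ i j Ei x /=.
have [dpsi apsi] := Hpsi; have [[_ zG _] _] := cz; have [[_ vG _] _] := cv.
have Ei1 : i.+1 = (j + s + n)%N by rewrite -addnA -Er addnS Ei.
have Ei2 : i.+1 = (j + (s + n))%N by rewrite addnA.
rewrite !linearD /=.
have E1 := HK i j Ei2 (psi i.+1 i.+1 x).
have E2 := HZ (j + s)%N j (erefl _) (cap z i.+1 (j + s)%N x).
have E3 := cvh (j + s)%N j (erefl _) (Y i.+1 (j + s).+1 x).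
have E4 := congr1 (vh (j + s)%N j) (HY i.+1 (j + s)%N Ei1 x).
have E5 := congr1 (psi j j) (@cap_boundary _ _ char_k c i j x cc).
have E6 : psi j j (cap (codiff c) i.+1 j x) = psi j j (cap v (j + s)%N j (cap z i.+1 (j + s)%N x)).
  by apply: congr1; apply: etrans (eq_cap j x dc) (esym (cap_comp j x hv vG zG)).
rewrite (cap_pdiff char_k _ cz hz Ei1) in E2.
rewrite !linearD /= in E4 E5.
rewrite dpsi in E1 *.
have [F1 F2 F3] : [/\ diff X j (K i.+1 j.+1 (psi i.+1 i.+1 x)) =
    vh (j + s)%N j (wh i.+1 (j + s)%N (psi i.+1 i.+1 x)) + K i j (psi i i (std_diff gT k i x)),
   diff X j (Z (j + s)%N j.+1 (cap z i.+1 (j + s)%N x)) =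
     vh (j + s)%N j (psi (j + s)%N (j + s)%N (cap z i.+1 (j + s)%N x)) +
     psi j j (cap v (j + s)%N j (cap z i.+1 (j + s)%N x)) +
     Z (j + s).-1 j (cap z i (j + s).-1 (std_diff gT k i x)) &
   psi j j (std_diff gT k j (cap c i.+1 j.+1 x)) =
     psi j j (cap (codiff c) i.+1 j x) + psi j j (cap c i j (std_diff gT k i x))].
  by split; rewrite -?E1 -?E5 ?E2; char2 (@M2 (X j)).
rewrite F1 F2 E3 dpsi F3 E6 E4; char2 (@M2 (X j)).
Qed.

(** The cocycle whose class is the value of the Massey product; [p] stands for
    the degree n + s - 1 of the homotopies. *)
Definition massey_val n p (u w H K : graded X X) : {linear X (p + n)%N -> kk} :=
  ((aug X \o H p 0) \o w (p + n)%N p) \+ (top n u \o K (p + n)%N n).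

Lemma homotopy_top n s p (u v H : graded X X) y : p.+1 = (n + s)%N ->
  homotopy n s u v H -> aug X (H p 0 (diff X p y)) = top n u (v p.+1 n y).
Proof.
move=> Ep HH; have := congr1 (aug X) (HH p 0 Ep y).
by rewrite linearD augK add0r.
Qed.

Lemma massey_val_cocycle n s p (u v w H K : graded X X) : p.+1 = (n + s)%N ->
  chain n u -> chain n w -> homotopy n s u v H -> homotopy s n v w K ->
  hom_cocycle (massey_val n p u w H K).
Proof.
move=> Ep cu cw HH HK y; rewrite /= -[w _ _ _](cw _ p) // (homotopy_top _ Ep HH).
have EN : (p + n).+1 = (n + (s + n))%N by rewrite -addSn Ep addnA.
have := congr1 (top n u) (HK (p + n)%N n EN y).
rewrite linearD top_cocycle // add0r /= => ->; rewrite -Ep; exact: M2.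
Qed.

(** The cocycle of any Massey product <z, v, z>, pulled back to the standard
    resolution, is cohomologous to H' z + a c + a eps, where a is the pullback
    of the cocycle of u, d H' = a v, d c = v z and eps a cocycle, the class of the chain map of
    [transfer_chain].  So [massey_cochain] computes it. *)
Lemma massey_val_ideal n s p z v (u v' w H K : graded X X) : p.+1 = (n + s)%N ->
  cocycle z -> homog n z -> cocycle v -> homog s v ->
  cohomologous (cup v z) (fun=> 0) ->
  chain_represents n u z -> chain_represents s v' v -> chain_represents n w z ->
  homotopy n s u v' H -> homotopy s n v' w K ->
  in_ideal z (fun t => coch (pull (massey_val n p u w H K)) t + cup v (cup1 z z) t).
Proof.
move=> Ep cz hz cv hv vz0.
move=> /chain_representsP [cu zu] /chain_representsP [cv' vE] /chain_representsP [cw zw] HH HK.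
have [dpsi apsi] := Hpsi; have [[_ zG _] _] := cz; have [[_ vG _] _] := cv.
have Er : p.+1 = (s + n)%N by rewrite addnC.
have [c0 cc0 dc0] := cohE vz0.
pose c := part p c0.
have cc : cochain c by apply: part_cochain.
have dc t : codiff c t = cup v z t.
  rewrite (codiff_part_homog (d := p.+1) char_k _ _ cc0 (f := cup v z)) //.
    by rewrite Er; apply: homog_cup.
  by move=> t'; rewrite dc0 add0r.
have hc : homog p c by apply: part_homog.
have [_ cG _] := cc.
have [Y HY] := compare_cap cz hz cw zw.
have [Z HZ] := compare_cap cv hv cv' vE.
have [E cE EE] : exists2 E : graded std X, @chain _ _ _ S X p E &
    forall i j x, E i j x = K i j (psi i i x) + Z (j + s).-1 j (cap z i (j + s).-1 x)
      + v' (j + s)%N j (Y i (j + s)%N x) + psi j j (cap c i j x).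
  by eexists; first exact: (transfer_chain cz hz cv hv cc dc Er cv' HK HY HZ).
pose eps : {linear std p -> kk} := aug X \o E p 0.
have deps x : eps (std_diff gT k p x) = 0 by rewrite /= -[E _ _ _](cE p 0) // augK.
have ceps := coch_cocycle char_k deps.
have heps := coch_homog eps.
have [||x|W HW _] := @chain_homotopic _ _ _ S X p E
  (fun i j => psi j j \o cap (coch eps) i j) \0.
- exact: cE.
- by move=> i j Ei x; rewrite /= dpsi cap_cocycle.
- have [[_ eG _] _] := ceps.
  rewrite /= addr0 apsi aug_cap //; apply: (std_eq (L := eps) (L' := lin _ (coch eps))) => t Et.
  by rewrite -/(coch (lin _ _) t) coch_lin.
pose N := (p + n)%N.
have ENp : N = (p + n)%N by [].
have ENn : N = (n + p)%N by rewrite addnC.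
(* Simplification must not expose the definitions of [fu] and [fH]. *)
have [fu Efu fuE] : exists2 fu, fu = top n u & forall x, fu x = aug X (u n 0 x).
  by exists (top n u).
rewrite -Efu in zu.
have fud : hom_cocycle fu by rewrite Efu; apply: top_cocycle cu.
have [fH fHE] : exists fH : {linear X p -> kk}, forall x, fH x = aug X (H p 0 x).
  by exists (aug X \o H p 0).
have fHd y : fH (diff X p y) = fu (v' p.+1 n y).
  by rewrite fHE (homotopy_top _ Ep HH) Efu.
pose H' : {linear std p -> kk} := (fH \o psi p p) \+ (fu \o Z p n).
have dH' x : H' (std_diff gT k p x) = pull fu (cap v p.+1 n x).
  rewrite /H' /= -dpsi fHd (HZ p.+1 n Ep) !linearD fud /=.
  char2 (@M2 kk).
pose cor : {linear std N.-1 -> kk} := (fH \o Y N.-1 p) \+ (fu \o W N.-1 n).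
pose main : {linear std N -> kk} := (H' \o cap z N p) \+ (pull fu \o cap c N n) \+
   (pull fu \o cap (coch eps) N n).
have valE x : pull (massey_val n p u w H K) x = main x + cor (pdiff S N x).
  rewrite /= -fHE -fuE.
  have E1 := congr1 fH (HY N p ENp x); rewrite !linearD fHd in E1.
  have E2 := congr1 fu (HW N n ENn x); rewrite EE -Ep !linearD fud addr0 /= in E2.
  have E3 : fu (K N n (psi N N x)) = fu (psi n n (cap (coch eps) N n x))
     + fu (W N.-1 n (pdiff S N x)) + fu (Z p n (cap z N p x))
     + fu (v' p.+1 n (Y N p.+1 x)) + fu (psi n n (cap c N n x)).
    rewrite -E2; char2 (@M2 kk).
  rewrite E1 E3.
  have aux (a1 a2 a3 a4 a5 a6 a7 : kk) :
    a1 + a3 + a2 + (a6 + a4 + a5 + a3 + a7) = a1 + a5 + a7 + a6 + (a2 + a4).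
    char2 (@M2 kk).
  exact: aux.
have [b cb bE] := cohE (coh_sym char_k zu).
have dH't t : codiff (coch H') t = cup (coch (pull fu)) v t.
  rewrite (coch_diff char_k) dH'.
  exact: (coch_cap (pull fu) t vG hv Ep).
have I := massey_cochain char_k cz cv cb cc (coch_cochain _) ceps bE dc dH't.
apply: (ideal_coh char_k _ I); apply: (cohD char_k _ (eq_coh char_k (frefl _))).
apply: (coh_trans char_k (coh_pdiff valE)).
apply: eq_coh => // t; have [[_ eG _] _] := ceps.
by rewrite -(coch_cap H' t zG hz ENp) -(coch_cap (pull fu) t cG hc ENn)
  -(coch_cap (pull fu) t eG heps ENn).
Qed.

Lemma massey_ideal n s z v m : (0 < n)%N ->
  cocycle z -> homog n z -> cocycle v -> homog s v ->
  cohomologous (cup v z) (fun=> 0) -> massey X n s n z v z m ->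
  in_ideal z (fun t => m t + cup v (cup1 z z) t).
Proof.
case: n => // n _ cz hz cv hv vz0 [u [v' [w [H [K [[zu vv zw] [HH HK mE]]]]]]].
have Ep : (n + s).+1 = (n.+1 + s)%N by [].
have I := massey_val_ideal Ep cz hz cv hv vz0 zu vv zw HH HK.
have /chain_representsP [cu _] := zu; have /chain_representsP [cw _] := zw.
apply: (ideal_coh char_k _ I); apply: (cohD char_k _ (eq_coh char_k (frefl _))).
apply/(representsP char_k Hpsi m (massey_val_cocycle Ep cu cw HH HK)).
by apply: eq_represents mE => x; rewrite linearD.
Qed.

Lemma comp_chain r s (u v : graded X X) : chain r u -> chain s v ->
  chain (r + s) (fun i j => u (j + r)%N j \o v i (j + r)%N).
Proof.
move=> cu cv i j Ei x /=; rewrite [LHS]cu // (cv i (j + r)%N) //.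
by rewrite Ei addnA.
Qed.

(** The bottom component of the composite represents the product of the classes,
    and so is a coboundary by [classes_injective]. *)
Lemma null_product r s (u v : graded X X) a b : (0 < r + s)%N ->
  chain r u -> cohomologous a (coch (pull (top r u))) ->
  cocycle b -> homog s b -> chain s v -> cohomologous b (coch (pull (top s v))) ->
  cohomologous (cup a b) (fun=> 0) -> exists H, homotopy r s u v H.
Proof.
move=> rs cu au cb hb cv bv ab0.
pose f : {linear X (r + s)%N -> kk} := top r u \o v (r + s)%N r.
have fd : hom_cocycle f.
  by move=> x; rewrite /f /= -(cv (r + s)%N r) // -(cu r 0) // augK.
have [||h Hh] := classes_injective char_k Hpsi (g := \0) fd.
- by [].
- apply: (coh_trans char_k (product_class (top_cocycle cu) cb hb cv bv)).
  apply: (coh_trans char_k (coh_cupl char_k (coh_sym char_k au) cb)).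
  by apply: (coh_trans char_k ab0); apply: eq_coh.
have [x|H HH _] := null_homotopy (k := h) (comp_chain cu cv).
  by have /= := Hh x; rewrite add0r.
exists H => i j Ei x; have /= := HH i.+1 j Ei x; by move=> ->.
Qed.

Lemma massey_exists n s z v : (0 < n)%N -> cocycle z -> homog n z ->
  cocycle v -> homog s v -> cohomologous (cup v z) (fun=> 0) ->
  exists m, massey X n s n z v z m.
Proof.
move=> n0 cz hz cv hv vz0.
have lift r y : cocycle y -> homog r y -> exists u : graded X X,
    chain r u /\ cohomologous y (coch (pull (top r u))).
  move=> cy hy; have [f fd yf] := classes_surjective char_k Hpsi cy hy.
  have [u cu uf] := chain_lift X fd; exists u; split=> //.
  by apply: (coh_trans char_k yf); apply: eq_coh => // t; rewrite /coch /= uf.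
have [u [cu zu]] := lift n z cz hz; have [w [cw vw]] := lift s v cv hv.
have zv0 := coh_trans char_k (coh_cupC char_k cz cv) vz0.
have ns0 : (0 < n + s)%N by rewrite addn_gt0 n0.
have [H HH] := null_product ns0 cu zu cv hv cw vw zv0.
have sn0 : (0 < s + n)%N by rewrite addnC.
have [K HK] := null_product sn0 cw vw cz hz cu zu vz0.
eexists; exists u, w, u, H, K; split.
  by split; apply/chain_representsP.
split=> //; exists (fun n s => psi n n (bas n s)); first exact: comparison_psi.
exact: eq_coh (frefl _).
Qed.

End Transfer.


(** * Bases of the cohomology over the prime field *)

Section PrimeFieldBasis.
Variables (gT : finGroupType) (k : fieldType).
Hypothesis char_k : 2%N \in [pchar k].
Local Notation act g s := [seq (g%g * x)%g | x <- s].
Variable n : nat.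
Implicit Types (y : seq gT -> 'F_2) (z : seq gT -> k).

Fact char_F2 : 2%N \in [pchar 'F_2]. Proof. exact: pchar_Fp. Qed.

(** Linear combinations are lists here, as terms are removed one by one. *)
Definition F2_comb (r : seq (k * (seq gT -> 'F_2))) s : k :=
  \sum_(p <- r) p.1 * F2_incl k (p.2 s).

Definition all_pairs (P : (seq gT -> 'F_2) -> Prop) (r : seq (k * (seq gT -> 'F_2))) :=
  foldr (fun p Q => P p.2 /\ Q) True r.

Definition F2_cochain y := cochain y /\ homog n y.

Definition F2_elem (f : {ffun n.-tuple gT -> 'F_2}) (s : seq gT) : 'F_2 :=
  if s is g :: s' then if insub (act g^-1 s') is Some t then f t else 0 else 0.

Lemma F2_elem_cochain f : F2_cochain (F2_elem f).
Proof.
have hf : homog n (F2_elem f).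
  case=> // g s ne /=; case: insubP => // t; rewrite size_map => /eqP E.
  by rewrite /= E eqxx in ne.
split=> //; split=> //; last first.
  by exists n.+1 => s ls; rewrite hf // neq_ltn ls orbT.
move=> g [|h s] //=; rewrite -map_comp; congr (if insub _ is Some t then f t else 0).
by apply: eq_map => x /=; rewrite invMg -mulgA mulKg.
Qed.

Lemma F2_elemE y : F2_cochain y -> exists f, forall s, y s = F2_elem f s.
Proof.
move=> [[y0 yG _] hy]; exists [ffun t : n.-tuple gT => y (1%g :: t)] => -[|g s] //=.
case: insubP => [t _ Et|ne]; last by rewrite hy //=; rewrite size_map in ne.
rewrite ffunE Et -[RHS](yG g) /= mulg1 -map_comp map_id_in // => x _ /=.
by rewrite mulKVg.
Qed.

Lemma cochain_F2_comb z : cochain z -> homog n z ->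
  exists2 r, all_pairs F2_cochain r & forall s, z s = F2_comb r s.
Proof.
move=> [z0 zG _] hz.
pose r := [seq (z (1%g :: t), F2_elem [ffun u => (u == t)%:R]) | t : n.-tuple gT].
exists r.
  by rewrite /r /image_mem; elim: (enum_mem _) => //= t e IH; split=> //; apply: F2_elem_cochain.
case=> [|g s]; rewrite /F2_comb big_map big_enum /=; first by rewrite z0 big1 // => t _; rewrite mulr0.
case: insubP => [t _ Et|ne]; last first.
  rewrite hz ?big1 //= => [t _|]; first by rewrite mulr0.
  by rewrite size_map in ne.
rewrite (bigD1 t) //= big1 ?addr0 => [|u ne]; last first.
  by rewrite ffunE eq_sym (negPf ne) /F2_incl mulr0.
rewrite ffunE eqxx /F2_incl mulr1 Et -[RHS](zG g) /= mulg1 -map_comp map_id_in // => x _ /=.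
by rewrite mulKVg.
Qed.

Lemma codiff_F2_comb r s :
  codiff (F2_comb r) s = \sum_(p <- r) p.1 * F2_incl k (codiff p.2 s).
Proof.
elim: r => [|p r IH].
  by rewrite big_nil codiffE // cobd_eq0 // => t _; rewrite /F2_comb big_nil.
rewrite big_cons -IH -F2_incl_codiff // -codiffZ // -codiffD //.
by apply: eq_codiff => // t; rewrite /F2_comb big_cons.
Qed.

Lemma F2_comb_cat r r' s : F2_comb (r ++ r') s = F2_comb r s + F2_comb r' s.
Proof. by rewrite /F2_comb big_cat. Qed.

Lemma F2_comb_shift (e : (seq gT -> 'F_2) -> 'F_2) y0 r s :
  F2_comb [seq (p.1, fun s => p.2 s + e p.2 * y0 s) | p <- r] s =
  F2_comb r s + (\sum_(p <- r) p.1 * F2_incl k (e p.2)) * F2_incl k (y0 s).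
Proof.
rewrite /F2_comb big_map mulr_suml -big_split /=; apply: eq_bigr => p _.
by rewrite F2_inclD // F2_inclM mulrDr mulrA.
Qed.

Lemma F2_eq0 (a : 'F_2) : a != 0 -> F2_incl k a = 1.
Proof. by case: a => -[|[|//]]. Qed.

Lemma all_pairs_cat P r r' : all_pairs P (r ++ r') <-> all_pairs P r /\ all_pairs P r'.
Proof.
by elim: r => [|p r IH] /=; [split=> [|[]] | split=> [[? /IH[]]|[[? ?] ?]]; do ?split=> //; apply/IH].
Qed.

(** Among the expressions of a cocycle z over k as a combination of cochains over
    F_2, a shortest one consists of cocycles: if d y_0 is not zero on some list
    s_0, evaluating d z = 0 at s_0 expresses the coefficient of y_0 through the
    other ones, with coefficients in F_2, and the term y_0 can be absorbed into
    the other terms. *)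
Lemma cocycle_F2_comb z : cocycle z -> homog n z ->
  exists2 r, all_pairs (fun y => cocycle y /\ homog n y) r & forall s, z s = F2_comb r s.
Proof.
move=> [cz dz] hz; have [r] := cochain_F2_comb cz hz.
have [m] := ubnP (size r); elim: m r => // m IH r lm gr zr.
have [cr|ncr] := classic (all_pairs (fun y => cocycle y /\ homog n y) r); first by exists r.
have [r1 [p0 [r2 [s0 [Er ds]]]]] : exists r1 p0 r2 s0,
    r = r1 ++ p0 :: r2 /\ codiff p0.2 s0 != 0.
  elim: r {lm zr} gr ncr => [|p r IHr] /=; first by move=> _ [].
  move=> [[cp hp] gr] nc.
  have [dp|/not_all_ex_not[s0 ds]] := classic (forall s, codiff p.2 s = 0); last first.
    by exists [::], p, r, s0; split=> //; apply/eqP.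
  have [|r1 [p0 [r2 [s0 [-> ds]]]]] := IHr gr; first by move=> ar; apply: nc.
  by exists (p :: r1), p0, r2, s0.
have dz0 : 0 = \sum_(p <- r1 ++ r2) p.1 * F2_incl k (codiff p.2 s0) + p0.1.
  rewrite -[LHS](dz s0) (eq_codiff char_k _ zr) codiff_F2_comb Er !big_cat big_cons /=.
  rewrite (F2_eq0 ds) mulr1; char2 (field_exponent2 char_k).
move: gr; rewrite Er => /all_pairs_cat [g1 /= [[c0 h0] g2]].
have g12 : all_pairs F2_cochain (r1 ++ r2) by apply/all_pairs_cat.
apply: (IH [seq (p.1, fun s => p.2 s + codiff p.2 s0 * p0.2 s) | p <- r1 ++ r2]).
- rewrite size_map size_cat; move: lm; rewrite Er size_cat /= addnS ltnS.
  by [].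
- elim: (r1 ++ r2) g12 => //= p r' IHr [[cp hp] /IHr ?]; split=> //; split.
    by apply: cochainD => //; apply: cochainZ.
  by move=> s ne; rewrite hp // h0 // mulr0 addr0.
move=> s; rewrite (F2_comb_shift (fun y => codiff y s0)) zr Er.
have -> : \sum_(p <- r1 ++ r2) p.1 * F2_incl k (codiff p.2 s0) = p0.1.
  by apply/eqP; rewrite -subr_eq0 [X in _ + X]oppr2 // -dz0.
by rewrite !F2_comb_cat /F2_comb big_cons -addrA; congr (_ + _); rewrite addrC.
Qed.

Definition F2_span m (u : 'I_m -> seq gT -> 'F_2) :=
  (forall i, cocycle (u i) /\ homog n (u i)) /\
  (forall z, cocycle z -> homog n z ->
     exists l : {ffun 'I_m -> k}, cohomologous z (lin_comb l u)).

(** There are finitely many cocycles of degree n over F_2, and all of them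
    together span. *)
Lemma F2_span_exists : exists m (u : 'I_m -> seq gT -> 'F_2), F2_span u.
Proof.
pose T := {ffun n.-tuple gT -> 'F_2}.
pose u (i : 'I_#|{: T}|) (s : seq gT) : 'F_2 :=
  if excluded_middle_informative (cocycle (F2_elem (enum_val i))) then F2_elem (enum_val i) s else 0.
exists #|{: T}|, u; split=> [i|z cz hz].
  have [_ hi] := F2_elem_cochain (enum_val i).
  rewrite /u; case: excluded_middle_informative => [ci|nci] /=; split=> //.
  exact: cocycle0 char_F2.
have [r gr zr] := cocycle_F2_comb cz hz.
suff [l Hl] : exists l : {ffun 'I_#|{: T}| -> k}, forall s, F2_comb r s = lin_comb l u s.
  by exists l; apply: eq_coh => // s; rewrite zr Hl.
elim: r gr {zr} => [_|p r IH /= [[[cy dy] hy] /IH [l Hl]]].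
  exists 0 => s; rewrite /F2_comb big_nil /lin_comb big1 // => i _.
  by rewrite ffunE mul0r.
have [f fE] := F2_elemE (conj cy hy).
exists [ffun i => (i == enum_rank f)%:R * p.1 + l i] => s.
rewrite /F2_comb big_cons -/(F2_comb r s) Hl /lin_comb.
under [RHS]eq_bigr => i _ do rewrite ffunE mulrDl.
rewrite big_split; congr (_ + _); rewrite (bigD1 (enum_rank f)) //= big1 => [|i /negPf ->].
  rewrite eqxx mul1r addr0 /u enum_rankK; case: excluded_middle_informative => [cf /=|[]].
    by rewrite fE.
  by apply: (eq_cocycle char_F2 fE).
by rewrite !mul0r.
Qed.

(** A spanning family that is not a basis satisfies a relation, by which one of
    its members can be dropped. *)
Lemma F2_basis_exists : exists m (u : 'I_m -> seq gT -> 'F_2), @F2_basis gT k n m u.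
Proof.
have [m [u]] := F2_span_exists; elim: m u => [|m IH] u [cu su].
  exists 0%N, u; split=> // z cz hz; have [l Hl] := su z cz hz; exists l; split=> // l' _.
  by apply/ffunP=> -[].
have [bu|nbu] := classic (@F2_basis gT k n m.+1 u); first by exists m.+1, u.
have [d [i di d0]] : exists d : 'I_m.+1 -> k, exists2 i, d i != 0 &
    cohomologous (lin_comb d u) (fun=> 0).
  apply: NNPP => nd; apply: nbu; split=> // z cz hz; have [l Hl] := su z cz hz.
  exists l; split=> // l' Hl'; apply/ffunP=> i; apply/eqP; rewrite -subr_eq0; apply: contraPT nd => di.
  case; exists (fun i => l i - l' i), i => //.
  have := cohD char_k (coh_trans char_k (coh_sym char_k Hl) Hl') (eq_coh char_k (frefl (lin_comb l' u))).
  move=> H; apply: (coh_trans char_k (coh_trans char_k (eq_coh char_k _) H)).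
    move=> s; rewrite /lin_comb -big_split; apply: eq_bigr => j _.
    by rewrite mulrBl [X in _ + X = _]oppr2.
  by apply: eq_coh => // s; apply: field_exponent2.
apply: (IH (fun j => u (lift i j))); split=> [j|z cz hz]; first exact: cu.
have [l Hl] := su z cz hz.
exists [ffun j => l (lift i j) + l i / d i * d (lift i j)].
have cC a (f f' : seq gT -> k) : cohomologous f f' -> cohomologous (fun s => a * f s) (fun s => a * f' s : k).
  move=> /cohE[c cc E]; apply: cohP; exists (fun s => a * c s); first exact: cochainZ.
  by move=> s; rewrite codiffZ // E mulrDr.
have H := cohD char_k Hl (coh_sym char_k (cC (l i / d i) _ _ d0)).
apply: (coh_trans char_k (coh_trans char_k (eq_coh char_k _) H)).
  by move=> s; rewrite mulr0 addr0.
apply: eq_coh => // s; rewrite /lin_comb mulr_sumr -big_split (bigD1_ord i) //=.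
rewrite mulrA divfK // (field_exponent2 char_k) add0r; apply: eq_bigr => j _.
by rewrite ffunE mulrDl mulrA.
Qed.

End PrimeFieldBasis.


(** * Projective modules and syzygies *)

Section ModuleGeneralities.
Variable A : pzRingType.

Lemma linear_ex (U V : lmodType A) (g : U -> V) : linear g ->
  exists L : {linear U -> V}, L =1 g.
Proof.
move=> glin; pose gL := GRing.isLinear.Build A U V *:%R g glin.
by pose L : {linear U -> V} := HB.pack g gL; exists L.
Qed.

Lemma pair_injections (U V : lmodType A) :
  exists (i1 : {linear U -> (U * V)%type}) (i2 : {linear V -> (U * V)%type}),
    forall x y, (x, y) = i1 x + i2 y.
Proof.
have [i1 i1E] : exists L : {linear U -> (U * V)%type}, forall x, L x = (x, 0).
  by apply: linear_ex => a x y; congr (_, _); rewrite /= scaler0 addr0.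
have [i2 i2E] : exists L : {linear V -> (U * V)%type}, forall x, L x = (0, x).
  by apply: linear_ex => a x y; congr (_, _); rewrite /= scaler0 addr0.
by exists i1, i2 => x y; rewrite i1E i2E; congr (_, _); rewrite /= ?addr0 ?add0r.
Qed.

Lemma projective_pair (U V : lmodType A) :
  projective U -> projective V -> projective (U * V)%type.
Proof.
move=> pU pV M N p f psurj; have [i1 [i2 iE]] := pair_injections U V.
have [g1 Hg1] := pU _ _ p (f \o i1) psurj; have [g2 Hg2] := pV _ _ p (f \o i2) psurj.
exists ((g1 \o fst) \+ (g2 \o snd)) => -[x y].
by rewrite /= linearD Hg1 Hg2 /= -linearD -iE.
Qed.

Lemma projective_retract (U V : lmodType A) (i : {linear U -> V}) (r : {linear V -> U}) :
  (forall x, r (i x) = x) -> projective V -> projective U.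
Proof.
move=> ri pV M N p f psurj; have [g Hg] := pV _ _ p (f \o r) psurj.
by exists (g \o i) => x; rewrite /= Hg /= ri.
Qed.

Lemma fin_gen_image (U V : lmodType A) (p : {linear U -> V}) :
  (forall y, exists x, p x = y) -> fin_gen U -> fin_gen V.
Proof.
move=> psurj [m [e He]]; exists m, (fun i => p (e i)) => y.
have [x <-] := psurj y; have [a ->] := He x; exists a.
by rewrite linear_sum; apply: eq_bigr => i _; rewrite linearZZ.
Qed.

Lemma fin_gen_pair (U V : lmodType A) : fin_gen U -> fin_gen V -> fin_gen (U * V)%type.
Proof.
move=> [m [e He]] [m' [e' He']].
exists (m + m')%N, (fun i => match split i with inl j => (e j, 0) | inr j => (0, e' j) end).
move=> [x y]; have [a ->] := He x; have [a' ->] := He' y.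
exists (fun i => match split i with inl j => a j | inr j => a' j end).
have [i1 [i2 iE]] := pair_injections U V.
rewrite iE !linear_sum big_split_ord; congr (_ + _); apply: eq_bigr => j _.
  by rewrite (unsplitK (inl j)) (linearZZ i1) -[i1 _]addr0 -(raddf0 i2) -iE.
by rewrite (unsplitK (inr j)) (linearZZ i2) -[i2 _]add0r -(raddf0 i1) -iE.
Qed.

Lemma syzygy_map_surj (N : lmodType A) (X : resolution N) n y :
  exists x, syzygy_map X n x = y.
Proof.
case: n y => [|n] y /=; first exact: aug_surj.
have /eqP E : aug_diff X n (ker_val y) == 0 by have := ker_valP y.
suff [x Ex] : exists x, diff X n x = ker_val y by exists x; apply: val_inj.
by case: n y E => [|n] y /= E; [apply/aug_exact | apply/diff_exact].
Qed.

Lemma syzygy_map_eq0 (N : lmodType A) (X : resolution N) n x :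
  syzygy_map X n x = 0 <-> exists y, diff X n y = x.
Proof.
case: n x => [|n] x /=; first exact: aug_exact.
rewrite -diff_exact; split=> [/(congr1 val)//|E]; exact: val_inj.
Qed.

(** The syzygy is the cokernel of the next differential. *)
Lemma syzygy_factor (N V : lmodType A) (X : resolution N) n (f : {linear X n -> V}) :
  hom_cocycle f -> exists zh : {linear syzygy X n -> V}, forall x, zh (syzygy_map X n x) = f x.
Proof.
move=> fd.
have sec y : exists x, syzygy_map X n x == y.
  by have [x <-] := syzygy_map_surj y; exists x.
pose pre y := xchoose (sec y).
have preE y : syzygy_map X n (pre y) = y by apply/eqP/(xchooseP (sec y)).
have f0 x y : syzygy_map X n x = syzygy_map X n y -> f x = f y.
  move=> E; have /syzygy_map_eq0[w Ew] : syzygy_map X n (x - y) = 0 by rewrite linearB E subrr.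
  by apply/eqP; rewrite -subr_eq0 -linearB -Ew fd.
have [zh zhE] : exists zh : {linear syzygy X n -> V}, zh =1 f \o pre.
  by apply: linear_ex => a x y; rewrite /= -linearP; apply: f0; rewrite linearP !preE.
by exists zh => x; rewrite zhE; apply: f0; rewrite preE.
Qed.

End ModuleGeneralities.


(** * A resolution of the kernel of a map on a syzygy *)

Section FiberResolution.
Variables (A : pzRingType) (N : lmodType A) (X : resolution N) (n : nat).
Hypothesis A2 : forall V : lmodType A, exponent2 V.
Variables (zh : {linear syzygy X n -> N}) (Z : graded X X).
Hypothesis zh_surj : forall y, exists x, zh x = y.
Hypothesis chZ : chain n Z.
Hypothesis topZ : forall x, aug X (Z n 0 x) = zh (syzygy_map X n x).

(** Let Z be a chain map that lifts zh to a map from the truncation of X at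
    degree n, which resolves the syzygy, to X, which resolves N.  The shifted
    mapping cone of Z has terms X (j + n) * X j.+1 for j >= 0 and X 0 in
    degree -1, and its homology is the kernel of zh, in degree 0.  Splitting off
    the term X 0 makes it a projective resolution of that kernel.  The resolution
    comes with the projections to X (j + n) and X j.+1 that express Ext of the
    kernel through that of the syzygy and of N. *)
Definition fiber j : lmodType A := (X (j + n)%N * X j.+1)%type.

Definition fiber_diff_fun j (w : fiber j.+1) : fiber j :=
  (diff X (j + n) w.1, Z (j.+1 + n)%N j.+1 w.1 + diff X j.+1 w.2).

Fact fiber_diff_linear j : linear (@fiber_diff_fun j).
Proof.
move=> a x y; congr (_, _); rewrite /= !linearP //.
by rewrite scalerDr addrACA.
Qed.
HB.instance Definition _ j :=
  GRing.isLinear.Build A (fiber j.+1) (fiber j) *:%R (@fiber_diff_fun j) (@fiber_diff_linear j).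
Definition fiber_diff j : {linear fiber j.+1 -> fiber j} := @fiber_diff_fun j.

Definition fiber_base : {linear fiber 0 -> X 0} := (Z n 0 \o fst) \+ (diff X 0 \o snd).

Lemma fiber_baseE w : fiber_base w = Z n 0 w.1 + diff X 0 w.2.
Proof. by []. Qed.

Lemma fiber_base_diff w : fiber_base (fiber_diff 0 w) = 0.
Proof. by rewrite fiber_baseE /= -(chZ (i := n)) // linearD diffK addr0 A2. Qed.

Lemma fiber_diffK j w : fiber_diff j (fiber_diff j.+1 w) = 0.
Proof.
congr (_, _) => /=; first exact: diffK.
by rewrite -(chZ (i := j.+1 + n)) // linearD diffK addr0 A2.
Qed.

Definition fib j : lmodType A :=
  match j with 0 => kernel fiber_base | i.+1 => fiber i.+1 end.

Definition fib_val j : {linear fib j -> fiber j} :=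
  match j return {linear fib j -> fiber j} with
  | 0 => (val : kernel fiber_base -> fiber 0)
  | i.+1 => idfun
  end.

Definition fib_diff j : {linear fib j.+1 -> fib j} :=
  match j return {linear fib j.+1 -> fib j} with
  | 0 => corestr fiber_base_diff
  | i.+1 => fiber_diff i.+1
  end.

Lemma fib_diffE j (y : fib j.+1) : fib_val j (fib_diff j y) = fiber_diff j y.
Proof. by case: j y. Qed.

Lemma fib_val_inj j : injective (fib_val j).
Proof.
case: j => [|j x y //].
exact: (val_inj : injective (val : kernel fiber_base -> fiber 0)).
Qed.

Lemma fib_val_base (y : fib 0) : fiber_base (fib_val 0 y) = 0.
Proof. by apply/eqP; have := ker_valP y. Qed.

Fact fib_aug_subproof (y : fib 0) :
  zh ((syzygy_map X n \o (fst \o fib_val 0)) y) = 0.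
Proof.
rewrite /= -topZ; have := congr1 (aug X) (fib_val_base y).
by rewrite fiber_baseE linearD augK addr0 linear0.
Qed.

Definition fib_aug : {linear fib 0 -> kernel zh} := corestr fib_aug_subproof.

Lemma fib_aug_surj y : exists x, fib_aug x = y.
Proof.
have [a Ea] := syzygy_map_surj (ker_val y).
have /eqP Ey : zh (ker_val y) == 0 by have := ker_valP y.
have /aug_exact[b Eb] : aug X (Z n 0 a) = 0 by rewrite topZ Ea.
have Ew : fiber_base (a, b) = 0 by rewrite fiber_baseE /= Eb A2.
have [w Hw] : exists w : kernel fiber_base, val w = (a, b).
  by have Kw : (a, b) \in ker_pred fiber_base; [apply/eqP | exists (Kernel Kw)].
by exists w; apply: val_inj; rewrite /= [ker_val w]Hw.
Qed.

Lemma fiber_exact_step j a b :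
  (exists a', diff X (j + n) a' = a) -> Z (j + n)%N j a + diff X j b = 0 ->
  exists w, fiber_diff j w = (a, b).
Proof.
move=> [a' <-]; rewrite -(chZ (i := j + n)) // -linearD => /diff_exact[b' Eb'].
by exists (a', b'); congr (_, _); rewrite /= Eb' addrA A2 add0r.
Qed.

Lemma fib_aug_exact y : fib_aug y = 0 <-> exists w, fib_diff 0 w = y.
Proof.
split=> [/(congr1 val) E|[w <-]].
  have [w Hw] : exists w, fiber_diff 0 w = ((fib_val 0 y).1, (fib_val 0 y).2).
    apply: fiber_exact_step; last exact: fib_val_base.
    exact/syzygy_map_eq0.
  by exists w; apply: fib_val_inj; rewrite fib_diffE [LHS]Hw -surjective_pairing.
apply: val_inj; have H : syzygy_map X n (diff X n w.1) = 0 by apply/syzygy_map_eq0; exists w.1.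
exact: H.
Qed.

Lemma fib_diff_exact j y : fib_diff j y = 0 <-> exists w, fib_diff j.+1 w = y.
Proof.
split=> [/(congr1 (fib_val j))|[w <-]]; last first.
  by apply: fib_val_inj; rewrite fib_diffE raddf0; apply: fiber_diffK.
rewrite fib_diffE raddf0 => -[E1 E2].
have [w Hw] : exists w, fiber_diff j.+1 w = (y.1, y.2).
  by apply: fiber_exact_step E2; apply/diff_exact.
by exists w; rewrite [LHS]Hw -surjective_pairing.
Qed.

Lemma fiber_projective j : projective (fiber j).
Proof. by apply: projective_pair; apply: term_projective. Qed.

Lemma fiber_fin_gen j : fin_gen (fiber j).
Proof. by apply: fin_gen_pair; apply: term_fin_gen. Qed.

Lemma fiber_base_surj y : exists w, fiber_base w = y.
Proof.
have [x Ex] := zh_surj (aug X y); have [a Ea] := syzygy_map_surj x.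
have /aug_exact[b Eb] : aug X (y - Z n 0 a) = 0.
  by rewrite linearB topZ Ea Ex subrr.
by exists (a, b); rewrite fiber_baseE /= Eb addrC subrK.
Qed.

(** [X 0] is projective, so that the surjection [fiber_base] splits. *)
Lemma fib_retraction j : exists r : {linear fiber j -> fib j}, forall y, r (fib_val j y) = y.
Proof.
case: j => [|j]; last by exists idfun.
have [t Ht] := @term_projective _ _ X 0 _ _ fiber_base idfun fiber_base_surj.
have qr w : fiber_base (((idfun : {linear fiber 0 -> fiber 0}) \- (t \o fiber_base)) w) = 0.
  by rewrite -[LHS]/(fiber_base (w - t (fiber_base w))) linearB Ht subrr.
exists (corestr qr) => y; apply: val_inj.
by rewrite /= -[X in t X]/(fiber_base (fib_val 0 y)) fib_val_base linear0 subr0.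
Qed.

Lemma fib_projective j : projective (fib j).
Proof.
by have [r Hr] := fib_retraction j; apply: projective_retract Hr (@fiber_projective j).
Qed.

Lemma fib_fin_gen j : fin_gen (fib j).
Proof.
have [r Hr] := fib_retraction j.
by apply: fin_gen_image (fiber_fin_gen j) => y; exists (fib_val j y).
Qed.

Definition fib_res : resolution (kernel zh) :=
  Resolution fib_projective fib_fin_gen fib_aug_surj fib_aug_exact fib_diff_exact.

(** The components of a cocycle on the resolution of the kernel: [v] is its image
    under the connecting homomorphism. *)
Lemma fib_functional (V : lmodType A) j (x : {linear fib j -> V}) :
  exists (h : {linear X (j + n)%N -> V}) (v : {linear X j.+1 -> V}),
  forall y, x y = h (fib_val j y).1 + v (fib_val j y).2.
Proof.
have [r Hr] := fib_retraction j; have [i1 [i2 iE]] := pair_injections (X (j + n)%N) (X j.+1).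
exists (x \o (r \o i1)), (x \o (r \o i2)) => y.
by rewrite /= -!linearD -iE -surjective_pairing Hr.
Qed.

End FiberResolution.


(** * Semi-productive classes *)

Section Ideal.
Variables (gT : finGroupType) (k : fieldType).
Hypothesis char_k : 2%N \in [pchar k].

Lemma ideal_homog z m p n : (0 < p + n)%N -> homog n z -> homog (p + n) m ->
  in_ideal z m -> exists2 e : seq gT -> k, cocycle e /\ homog p e & cohomologous m (cup e z).
Proof.
move=> pn hz hm [e ce /cohE [c cc E]].
exists (part p e); first by split; [apply: part_cocycle | apply: part_homog].
apply: cohP; exists (part (p + n).-1 c); first exact: part_cochain.
move=> s; rewrite (cup_part _ _ _ hz) codiff_part // prednK // /part.
by case: ifPn => [_|/hm ->]; rewrite ?addr0.
Qed.

Lemma ideal_cancel z f h : in_ideal z (fun s => f s + h s : k) -> in_ideal (gT := gT) z f -> in_ideal z h.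
Proof.
move=> Ifh If; apply: (ideal_coh char_k _ (idealD char_k Ifh If)); apply: eq_coh => // s.
have k2 := field_exponent2 char_k; char2 k2.
Qed.

End Ideal.

Section SemiProductiveClasses.
Variables (gT : finGroupType) (k : fieldType).
Local Notation kG := (grpalg gT k).
Local Notation kk := (trivmod gT k : lmodType kG).
Local Notation std := (std gT k).
Hypothesis char_k : 2%N \in [pchar k].
Local Notation S := (std_res gT char_k).
Let M2 (V : lmodType kG) : exponent2 V := module_exponent2 char_k (V := V).
Variables (X : resolution kk) (psi : graded std X).
Hypothesis Hpsi : std_comparison psi.
Local Notation pull := (pull psi).
Variables (n : nat) (n_gt0 : (0 < n)%N).
Variable z : seq gT -> k.
Hypotheses (cz : cocycle z) (hz : homog n z) (z_neq0 : ~ cohomologous z (fun=> 0)).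

(** The condition on Steenrod squares, on homogeneous cochains; the conditions on
    Ext and on Massey products are compared with it. *)
Definition Sq_condition : Prop := forall s (v : seq gT -> k), cocycle v -> homog s v ->
  cohomologous (cup v z) (fun=> 0) -> in_ideal z (cup v (cup1 z z)).

(** A cocycle of degree 0 is a constant, and a nonzero constant cannot annihilate
    a nonzero class. *)
Lemma zero_degree_annihilator v : cocycle v -> homog 0 v ->
  cohomologous (cup v z) (fun=> 0) -> forall s, v s = 0.
Proof.
move=> [[v0 vG _] dv] hv vz0.
have vE s : size s = 1%N -> v s = v [:: 1%g].
  by case: s => [|g [|]] // _; rewrite -[RHS](vG g) /= mulg1.
have vzE s : cup v z s = v [:: 1%g] * z s.
  have [Es|ne] := eqVneq (size s) n.+1; last first.
    rewrite (homog_cup hv hz) // hz ?mulr0 //.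
  by rewrite (cup_homogr v hz (j := 0)) // drop0 vE // size_takel ?Es.
have [v10|v1] := eqVneq (v [:: 1%g]) 0.
  by move=> s; have [Es|/hv//] := eqVneq (size s) 1%N; rewrite vE.
case: z_neq0; have /cohE[c cc E] := vz0.
apply: cohP; exists (fun s => (v [:: 1%g])^-1 * c s); first exact: cochainZ.
move=> s; rewrite codiffZ // add0r.
by have := E s; rewrite vzE add0r => <-; rewrite mulKf.
Qed.

Variable Z : graded X X.
Hypotheses (chZ : chain n Z) (repZ : cohomologous z (coch (pull (top n Z)))).

(** Membership in the ideal (z), read on an arbitrary resolution. *)
Lemma ideal_pull p (y : {linear X (p + n)%N -> kk}) : hom_cocycle y ->
  in_ideal z (coch (pull y)) <->
  exists e : {linear X p -> kk}, hom_cocycle e /\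
    exists h : {linear X (p + n).-1 -> kk},
      forall x, y x = e (Z (p + n)%N p x) + h (pdiff X (p + n) x).
Proof.
move=> yd; split.
  have pn : (0 < p + n)%N by rewrite addn_gt0 n_gt0 orbT.
  case/(ideal_homog char_k pn hz (coch_homog _)) => e [ce he] yE.
  have [e' e'd eE] := classes_surjective char_k Hpsi ce he; exists e'; split=> //.
  apply: (classes_injective char_k Hpsi (g := e' \o Z (p + n)%N p)) => //.
    by move=> x; rewrite /= -(chZ (i := p + n)) // e'd.
  apply: (coh_trans char_k yE); apply: (coh_trans char_k (coh_cupl char_k eE cz)).
  exact: (coh_sym char_k (product_class char_k Hpsi e'd cz hz chZ repZ)).
case=> e [ed [h yE]]; exists (coch (pull e)).
  exact: (coch_cocycle char_k (pull_cocycle Hpsi ed)).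
have E := pull_cohomologous char_k Hpsi (g := e \o Z (p + n)%N p) yE.
exact: (coh_trans char_k E (product_class char_k Hpsi ed cz hz chZ repZ)).
Qed.

Section FiberLift.
Variables (i : nat) (V K : graded X X).
Hypotheses (chV : chain i.+1 V) (HK : homotopy i.+1 n V Z K).

(** The map (a, b) |-> V b + K a.  It lifts the cocycle f' b + h a, where f' and h
    are the bottom components of V and K; every class of Ext^i(L, k) has this form
    by [fib_functional]. *)
Definition fiber_lift j : {linear fib n Z (j + i)%N -> X j} :=
  ((V (j + i).+1 j \o snd) \+ (K (j + i + n)%N j \o fst)) \o fib_val n Z (j + i)%N.

Lemma fiber_lift_chain j y :
  diff X j (fiber_lift j.+1 y) = fiber_lift j (fib_diff M2 chZ (j + i)%N y).
Proof.
have Ei : (j + i + n).+1 = (j + (i.+1 + n))%N by rewrite -addSn -addnS addnA.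
rewrite /fiber_lift /= fib_diffE /= !linearD /= (chV (i := (j + i).+1)) ?addnS //.
have E := HK Ei (fib_val n Z (j.+1 + i)%N y).1; rewrite addnS in E.
rewrite -E; char2 (@M2 (X j)).
Qed.
End FiberLift.

End SemiProductiveClasses.

Section Equivalence.
Variables (gT : finGroupType) (k : fieldType).
Local Notation kG := (grpalg gT k).
Local Notation kk := (trivmod gT k : lmodType kG).
Local Notation std := (std gT k).
Hypothesis char_k : 2%N \in [pchar k].
Local Notation S := (std_res gT char_k).
Let M2 (V : lmodType kG) : exponent2 V := module_exponent2 char_k (V := V).
Variables (X : resolution kk) (n' : nat).
Local Notation n := n'.+1.
Variable z : seq gT -> k.
Hypotheses (cz : cocycle z) (hz : homog n z) (z_neq0 : ~ cohomologous z (fun=> 0)).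

(** Such a functional is nonzero since its class is, and k is a field. *)
Lemma nonzero_surj (zh : {linear syzygy X n -> kk}) :
  represents (fun y : X n => zh (syzygy_map X n y)) z -> forall y, exists x, zh x = y.
Proof.
move=> [phi _ zE] y.
have [[x /eqP zx]|nx] := classic (exists x, zh x <> 0); last first.
  case: z_neq0; apply: (coh_trans char_k zE); apply: eq_coh => // s.
  by case: ifP => // _; apply: NNPP => ne; apply: nx; eexists; exact: ne.
exists (ksc gT ((y : k) / zh x) *: x); rewrite (linearZZ zh) ksc_triv.
by rewrite divfK.
Qed.

(** Let v z = 0, with null homotopies H of Z V and K of V Z.  On the resolution of
    L by pairs (a, b), the map [fiber_lift] sends (a, b) to V b + K a, and the
    splice with z of its class is the cocycle f V b + f K a, where f is the cocycle
    of z.  If it is the coboundary of h' a + v' b, then f V = v' d and f K = h' d + v' Z.  As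
    also f V = g d, where g is the bottom of H, the cocycle g + v' multiplied by Z
    agrees up to the coboundary h' d with g Z + f K, which represents the Massey
    product <z, v, z>. *)
Lemma semi_productive_Sq : semi_productive X n z -> Sq_condition z.
Proof.
move=> SP s v cv hv vz0.
have [psi Hpsi] := exists_std_comparison char_k X.
case: s hv => [|i] hv.
  apply: (ideal_coh char_k _ (ideal0 char_k z)); apply: eq_coh => // t.
  exact: (cup0l _ _ (zero_degree_annihilator char_k hz z_neq0 cv hv vz0)).
have [f fd zf] := classes_surjective char_k Hpsi cz hz.
have [zh zhE] := syzygy_factor fd.
have [Z chZ Zf] := chain_lift X fd.
have repZ : cohomologous z (coch (pull psi (top n Z))).
  by apply: (coh_trans char_k zf); apply: eq_coh => // t; rewrite /coch /= Zf.
have topZ x : aug X (Z n 0 x) = zh (syzygy_map X n x) by rewrite zhE.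
have zh_rep : represents (fun y : X n => zh (syzygy_map X n y)) z.
  by apply: (eq_represents char_k (f := f)) => //; apply/(representsP char_k Hpsi).
have zh_surj := nonzero_surj zh_rep.
have [f' f'd vf'] := classes_surjective char_k Hpsi cv hv.
have [V chV Vf'] := chain_lift X f'd.
have repV : cohomologous v (coch (pull psi (top i.+1 V))).
  by apply: (coh_trans char_k vf'); apply: eq_coh => // t; rewrite /coch /= Vf'.
have zv0 := coh_trans char_k (coh_cupC char_k cz cv) vz0.
have [H HH] := null_product char_k Hpsi (isT : 0 < n + i.+1)%N chZ repZ cv hv chV repV zv0.
have [K HK] := null_product char_k Hpsi (isT : 0 < i.+1 + n)%N chV repV cz hz chZ repZ vz0.
pose F := fib_res M2 zh_surj chZ topZ.
have lift_chain := fiber_lift_chain char_k chZ chV HK.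
pose x : {linear F i -> kk} := aug X \o fiber_lift n Z i V K 0.
have xd : hom_cocycle x.
  by move=> y; have := congr1 (aug X) (lift_chain 0 y); rewrite augK => E0; exact: esym E0.
have [//|x' x'E] := SP zh zh_rep F i x xd (fiber_lift n Z i V K) _ lift_chain.
have [h' [v' hv']] := fib_functional zh_surj topZ (x' : {linear fib n Z (n' + i)%N -> kk}).
(* The splice is the coboundary of x'; its components in a and b are compared
   separately. *)
have E a b : top n Z (V (n + i).+1 n b + K (n + i + n)%N n a) =
    h' (diff X (n' + i + n) a) + v' (Z (n + i + n)%N (n + i)%N a + diff X (n + i) b).
  have := hv' (fib_diff M2 chZ (n' + i)%N ((a, b) : fib n Z (n' + i).+1)).
  rewrite fib_diffE /= => Ey; rewrite -[RHS]Ey.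
  have Ex := x'E ((a, b) : fib n Z (n' + i).+1); rewrite -topZ in Ex.
  by rewrite -[RHS]Ex.
have Ep : (n + i).+1 = (n + i.+1)%N by rewrite addnS.
have EV b : top n Z (V (n + i).+1 n b) = v' (diff X (n + i) b).
  by have := E 0 b; rewrite !raddf0 addr0 !add0r.
have EK a : top n Z (K (n + i + n)%N n a) = h' (diff X (n' + i + n) a) + v' (Z (n + i + n)%N (n + i)%N a).
  by have := E a 0; rewrite !raddf0 addr0 !add0r.
have rZ : chain_represents n Z z by apply/(chain_representsP char_k Hpsi).
have rV : chain_represents i.+1 V v by apply/(chain_representsP char_k Hpsi).
have vald := massey_val_cocycle char_k Ep chZ chZ HH HK.
have Iv := massey_val_ideal char_k Hpsi Ep cz hz cv hv vz0 rZ rV rZ HH HK.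
apply: ideal_cancel Iv _ => //.
apply/(ideal_pull char_k Hpsi (ltn0Sn n') cz hz chZ repZ vald).
exists ((aug X \o H (n + i)%N 0) \+ v'); split.
  by move=> y; rewrite /= (homotopy_top _ Ep HH) EV; apply: M2.
exists h' => a.
rewrite -[LHS]/(aug X (H (n + i)%N 0 (Z (n + i + n)%N (n + i)%N a)) + top n Z (K (n + i + n)%N n a)).
by rewrite EK -addrA; congr (_ + _); apply: addrC.
Qed.

(** The same computation backwards.  The given resolution Q of L is replaced by
    the one by pairs, over which the given lift of x is homotopic to a
    [fiber_lift]; if g Z + f K = e Z + ka d with a cocycle e, then f V b + f K a is
    the coboundary of ka a + (e + g) b. *)
Lemma Sq_semi_productive : Sq_condition z -> semi_productive X n z.
Proof.
move=> SqC zh zh_rep Q i x xd xh xh0 xhd.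
have [psi Hpsi] := exists_std_comparison char_k X.
have zh_surj := nonzero_surj zh_rep.
pose f : {linear X n -> kk} := zh \o syzygy_map X n.
have fd : hom_cocycle f.
  move=> y; rewrite /f /=; suff -> : syzygy_map X n (diff X n y) = 0 by rewrite linear0.
  by apply/syzygy_map_eq0; exists y.
have zf : cohomologous z (coch (pull psi f)) by apply/(representsP char_k Hpsi _ fd).
have [Z chZ topZ] := chain_lift X fd.
have repZ : cohomologous z (coch (pull psi (top n Z))).
  by apply: (coh_trans char_k zf); apply: eq_coh => // t; rewrite /coch /= topZ.
pose F := fib_res M2 zh_surj chZ topZ.
have [al chal alE] := @chain_lift _ _ _ F Q 0 (aug F) (@augK _ _ F).
have [be chbe beE] := @chain_lift _ _ _ Q F 0 (aug Q) (@augK _ _ Q).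
have dal j y : diff Q j (al j.+1 j.+1 y) = al j j (diff F j y).
  by rewrite (chal j j) ?addn0.
have dbe j y : diff F j (be j.+1 j.+1 y) = be j j (diff Q j y).
  by rewrite (chbe j j) ?addn0.
have [||hQ hQE] := @chain_homotopic_id _ _ Q (fun j => al j j \o be j j).
- by move=> j y; rewrite /= dal dbe.
- by move=> y; rewrite /= alE beE.
(* The components of x, transported to the resolution by pairs. *)
have [h [f' x'E]] := fib_functional zh_surj topZ (x \o al i i : {linear fib n Z i -> kk}).
have x'd (w : fib n Z i.+1) : h (diff X (i + n) w.1) +
    f' (Z (i.+1 + n)%N i.+1 w.1 + diff X i.+1 w.2) = 0.
  have := x'E (fib_diff M2 chZ i w); rewrite fib_diffE => <-.
  by rewrite /= -[fib_diff _ _ _ _]/(diff F i w) -dal xd.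
have f'd : hom_cocycle f'.
  by move=> b; have := x'd ((0, b) : fib n Z i.+1); rewrite !raddf0 !add0r.
have f'Z a : f' (Z (i.+1 + n)%N i.+1 a) = h (diff X (i + n) a).
  have := x'd ((a, 0) : fib n Z i.+1); rewrite !raddf0 addr0 => E.
  by rewrite -[RHS]addr0 -(M2 (f' (Z (i.+1 + n)%N i.+1 a))) addrA E add0r.
pose v := coch (pull psi f').
have cv : cocycle v := coch_cocycle char_k (pull_cocycle Hpsi f'd).
have hv : homog i.+1 v := coch_homog _.
have [V chV Vf'] := chain_lift X f'd.
have repV : cohomologous v (coch (pull psi (top i.+1 V))).
  by apply: eq_coh => // t; rewrite /v /coch /= Vf'.
have vz0 : cohomologous (cup v z) (fun=> 0).
  apply: (coh_trans char_k (coh_sym char_k (product_class char_k Hpsi f'd cz hz chZ repZ))).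
  have E := pull_cohomologous char_k Hpsi (f := f' \o Z (i.+1 + n)%N i.+1) (g := \0) (h := h).
  apply: (coh_trans char_k (E _)); last exact: eq_coh.
  by move=> a; rewrite /= f'Z add0r.
have zv0 := coh_trans char_k (coh_cupC char_k cz cv) vz0.
have [H HH] := null_product char_k Hpsi (isT : 0 < n + i.+1)%N chZ repZ cv hv chV repV zv0.
have [a|K HK0 Kh] := @null_homotopy _ _ _ X X (i.+1 + n) _ h (comp_chain chV chZ).
  by rewrite /= Vf' f'Z.
have HK : homotopy i.+1 n V Z K.
  by move=> a b Ei y; have /= := HK0 a.+1 b Ei y => ->.
have lift_chain := fiber_lift_chain char_k chZ chV HK.
have Ep : (n + i).+1 = (n + i.+1)%N by rewrite addnS.
have rZ : chain_represents n Z z by apply/(chain_representsP char_k Hpsi).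
have rV : chain_represents i.+1 V v by apply/(chain_representsP char_k Hpsi).
have vald := massey_val_cocycle char_k Ep chZ chZ HH HK.
have Iv := massey_val_ideal char_k Hpsi Ep cz hz cv hv vz0 rZ rV rZ HH HK.
have Is := SqC i.+1 v cv hv vz0.
have {Is}Iv : in_ideal z (coch (pull psi (massey_val n (n + i) Z Z H K))).
  have I2 : in_ideal z (fun t => cup v (cup1 z z) t
      + coch (pull psi (massey_val n (n + i) Z Z H K)) t).
    by apply: (ideal_coh char_k _ Iv); apply: eq_coh => // t; apply: addrC.
  exact: (ideal_cancel char_k I2 Is).
have /(ideal_pull char_k Hpsi (ltn0Sn n') cz hz chZ repZ vald) [e [ed [ka valE]]] := Iv.
(* The functional ka a + (e + g) b, with g the bottom component of H. *)
pose G : {linear fib n Z (n' + i)%N -> kk} :=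
  ((ka \o fst) \+ (e \o snd) \+ ((aug X \o H (n + i)%N 0) \o snd)) \o fib_val n Z (n' + i)%N.
have GE (y : fib n Z (n' + i).+1) :
    top n Z (fiber_lift n Z i V K n y) = G (fib_diff M2 chZ (n' + i)%N y).
  case: y => a b; rewrite /G /= fib_diffE /= !linearD /= (homotopy_top _ Ep HH) ed addr0.
  have E : ka (diff X (n' + i + n) a) + e (Z ((n' + i).+1 + n)%N (n' + i).+1 a) =
      aug X (H (n + i)%N 0 (Z ((n' + i).+1 + n)%N (n' + i).+1 a)) + top n Z (K (n + i + n)%N n a).
    by rewrite addrC; exact: esym (valE a).
  rewrite E -[LHS]/(top n Z (V (n + i).+1 n b) + top n Z (K (n + i + n)%N n a)).
  char2 (@M2 kk).
(* On the resolution by pairs, the given lift is homotopic to [fiber_lift]. *)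
have [U HU'] := @graded_extend _ F X (fun j => j + i)%N (fun j => xh j \o al (j + i)%N (j + i)%N).
have HU j y : U (j + i)%N j y = xh j (al (j + i)%N (j + i)%N y) by rewrite HU'.
have [L HL'] := @graded_extend _ F X (fun j => j + i)%N (fiber_lift n Z i V K).
have HL j y : L (j + i)%N j y = fiber_lift n Z i V K j y by rewrite HL'.
have [||y|ht Hht _] := @chain_homotopic _ _ _ F X i U L \0.
- move=> _ j -> y; have := xhd j (al (j.+1 + i)%N (j.+1 + i)%N y).
  by rewrite dal -!HU => E; exact: E.
- by move=> _ j -> y; have := lift_chain j y; rewrite -!HL => E; exact: E.
- rewrite [U _ _ _](HU 0) [L _ _ _](HL 0) [RHS]addr0 xh0 [LHS]x'E /fiber_lift /= linearD Vf'.
  by rewrite [X in _ = _ + X]Kh addrC.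
pose D : {linear Q (n' + i)%N -> kk} := (G \o be (n' + i)%N (n' + i)%N) \+
  (top n Z \o ht (n' + i)%N n \o be (n' + i)%N (n' + i)%N) \+
  (top n Z \o xh n \o hQ (n' + i)%N (n + i)%N).
have dxh w : top n Z (xh n (diff Q (n + i)%N w)) = 0.
  by rewrite -xhd; apply: top_cocycle chZ _.
exists D => y.
have E1 := congr1 (fun w => top n Z (xh n w)) (hQE (n + i)%N y).
have E2 := congr1 (top n Z) (Hht (n + i)%N n (erefl _) (be (n + i)%N (n + i)%N y)).
rewrite !linearD dxh addr0 in E1.
rewrite !linearD (top_cocycle chZ) addr0 HU HL GE in E2.
have dbey : fib_diff M2 chZ (n' + i)%N (be (n + i)%N (n + i)%N y) =
    be (n' + i)%N (n' + i)%N (diff Q (n' + i)%N y) := dbe (n' + i)%N y.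
rewrite -[pdiff F _ _]/(fib_diff M2 chZ (n' + i)%N (be (n + i)%N (n + i)%N y)) dbey in E2.
have E : top n Z (xh n y) = G (be (n' + i)%N (n' + i)%N (diff Q (n' + i)%N y)) +
    top n Z (ht (n + i).-1 n (be (n' + i)%N (n' + i)%N (diff Q (n' + i)%N y))) +
    top n Z (xh n (hQ (n + i).-1 (n + i)%N (pdiff Q (n + i)%N y))).
  by rewrite -E2 [X in X + _]E1 -addrA M2 addr0.
exact: etrans (esym (topZ _)) E.
Qed.

End Equivalence.

(** * The equivalence *)


(** As z is homogeneous, it is annihilated by v only if it is annihilated by each
    component of v. *)
Lemma Sq_condition_inhomogeneous (gT : finGroupType) (k : fieldType)
    (char_k : 2%N \in [pchar k]) n (z : seq gT -> k) v : (0 < n)%N -> homog n z ->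
  Sq_condition z -> cocycle v -> cohomologous (cup v z) (fun=> 0) ->
  in_ideal z (cup v (cup1 z z)).
Proof.
move=> n0 hz SqC cv /cohE[c cc vzE].
have [N vE] := part_sum (cocycleP cv).
have [r Er] : exists r, forall s, v s = \sum_(d <- r) part d v s.
  by exists (index_iota 0 N) => s; rewrite vE big_mkord.
suff : in_ideal z (cup (fun s => \sum_(d <- r) part d v s) (cup1 z z)).
  by apply: ideal_coh => //; apply: eq_coh => // s; apply: eq_cup.
elim: r {Er} => [|d r IH].
  apply: (ideal_coh char_k _ (ideal0 char_k z)); apply: eq_coh => // s.
  by apply: cup0l => t; rewrite big_nil.
have Id : in_ideal z (cup (part d v) (cup1 z z)).
  apply: (SqC d); [exact: part_cocycle|exact: part_homog|].
  apply: cohP; exists (part (d + n).-1 c); first exact: part_cochain.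
  move=> s; rewrite (cup_part _ _ _ hz) codiff_part // prednK ?addn_gt0 ?n0 ?orbT //.
  by rewrite add0r /part vzE add0r.
apply: (ideal_coh char_k _ (idealD char_k Id IH)); apply: eq_coh => // s.
by rewrite -cupDl; apply: eq_cup => // t; rewrite big_cons.
Qed.

Theorem theorem1p5 (gT : finGroupType) (k : fieldType)
    (char_k : 2%N \in [pchar k])
    (P : resolution (trivmod gT k : lmodType (grpalg gT k)))
    (M : resolution (trivmod gT k : lmodType (grpalg gT k)))
    (min_M : minimal M)
    (n : nat) (n_ge1 : (1 <= n)%N)
    (z : seq gT -> k) (z_cocycle : cocycle z) (z_deg : homog n z)
    (z_neq0 : ~ cohomologous z (fun=> 0)) :
  [<-> semi_productive M n z;
       forall (s : nat) (v : seq gT -> k), cocycle v -> homog s v ->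
         cohomologous (cup v z) (fun=> 0) ->
         forall m : seq gT -> k, massey P n s n z v z m -> in_ideal z m;
       forall v : seq gT -> k, cocycle v ->
         cohomologous (cup v z) (fun=> 0) ->
         forall w : seq gT -> k, semilin_Sq n z w -> in_ideal z (cup v w)].
Proof.
have [psi Hpsi] := exists_std_comparison char_k P.
case: n n_ge1 z_deg => // n n_ge1 z_deg; tfae.
- move=> /(semi_productive_Sq char_k z_cocycle z_deg z_neq0) SqC s v cv hv vz0 m mE.
  have Im := massey_ideal char_k Hpsi n_ge1 z_cocycle z_deg cv hv vz0 mE.
  apply: (ideal_cancel char_k _ (SqC s v cv hv vz0)).
  by apply: (ideal_coh char_k _ Im); apply: eq_coh => // t; apply: addrC.
- move=> Massey v cv vz0 w wE.
  suff SqC : Sq_condition z.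
    apply: (ideal_coh char_k _ (Sq_condition_inhomogeneous char_k n_ge1 z_deg SqC cv vz0)).
    exact: (coh_cupr char_k (semilin_Sq_cup1 char_k wE) cv).
  move=> s v' cv' hv' vz0'.
  have [m mE] := massey_exists char_k Hpsi n_ge1 z_cocycle z_deg cv' hv' vz0'.
  have Im := massey_ideal char_k Hpsi n_ge1 z_cocycle z_deg cv' hv' vz0' mE.
  exact: (ideal_cancel char_k Im (Massey s v' cv' hv' vz0' m mE)).
move=> SqT; apply: (Sq_semi_productive char_k z_cocycle z_deg z_neq0) => s v cv hv vz0.
have [m [u bu]] := F2_basis_exists gT char_k n.+1.
have [_ /(_ z z_cocycle z_deg) [l [zl _]]] := bu.
pose w := lin_comb (fun i => l i ^+ 2) (fun i => Sq_pred (u i)).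
have wE : semilin_Sq n.+1 z w.
  by exists m, u, l; split=> //; apply: eq_coh.
apply: (ideal_coh char_k _ (SqT v cv vz0 w wE)).
exact: (coh_cupr char_k (coh_sym char_k (semilin_Sq_cup1 char_k wE)) cv).
Qed.
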